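(* Let $F:[0,\infty)\to\mathbb{R}$ be $C^{1,1}$ with $F'(0)=0$, let $\Sigma=\{(w,F(|w|)):w\in\mathbb{R}^2\}\subset\mathbb{R}^3$, and set $M:=\max\{1,\limsup_{t\downarrow0}|F'(t)|/t\}$. There exist $\epsilon>0$, $L=L(M)>1$ (depending only on $M$), and a neighborhood $U\subset\Sigma$ of $(0,0,F(0))$ such that $(U,d_{\mathbb{H}})$ $L$-bi-Lipschitz embeds in $\mathbb{R}^4$.
   Context: For $w=(x,y,z)$, $w'=(x',y',z')$, $d_{\mathbb{H}}(w,w')=|x-x'|+|y-y'|+|z-z'+\tfrac12(xy'-x'y)|^{1/2}$. $(A,d_{\mathbb{H}})$ $L$-bi-Lipschitz embeds in $\mathbb{R}^4$ if there is $f:A\to\mathbb{R}^4$ with $L^{-1}d_{\mathbb{H}}(a,b)\le|f(a)-f(b)|\le Ld_{\mathbb{H}}(a,b)$ for all $a,b\in A$. *)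

(* Defs.v *)
From Stdlib Require Import Reals.
From Coquelicot Require Import Coquelicot.
Open Scope R_scope.

Definition dH (w w' : R * R * R) : R :=
  let '(x, y, z) := w in
  let '(x', y', z') := w' in
  Rabs (x - x') + Rabs (y - y') + sqrt (Rabs (z - z' + / 2 * (x * y' - x' * y))).

Definition dist3 (p q : R * R * R) : R :=
  let '(a, b, c) := p in let '(a', b', c') := q in
  sqrt ((a - a') ^ 2 + (b - b') ^ 2 + (c - c') ^ 2).

Definition dist4 (p q : R * R * R * R) : R :=
  let '(a, b, c, d) := p in let '(a', b', c', d') := q in
  sqrt ((a - a') ^ 2 + (b - b') ^ 2 + (c - c') ^ 2 + (d - d') ^ 2).

(* F : [0,oo) -> R is C^{1,1} with derivative F' : F is differentiable at every
   t > 0 with derivative F' t, has right derivative F' 0 at 0, and F' is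
   Lipschitz on [0,oo).  (Values of F, F' at negative arguments are irrelevant.) *)
Definition C11_halfline (F F' : R -> R) : Prop :=
  (forall t, 0 < t -> is_derive F t (F' t)) /\
  filterlim (fun h => (F h - F 0) / h) (at_right 0) (locally (F' 0)) /\
  (exists K, forall s t, 0 <= s -> 0 <= t -> Rabs (F' s - F' t) <= K * Rabs (s - t)).

Definition limsup_right0 (g : R -> R) : Rbar :=
  Glb_Rbar (fun y => exists d, 0 < d /\
              Finite y = Lub_Rbar (fun z => exists t, 0 < t < d /\ z = g t)).

Definition M_of (F' : R -> R) : R :=
  Rmax 1 (real (limsup_right0 (fun t => Rabs (F' t) / t))).

Definition Sigma (F : R -> R) (p : R * R * R) : Prop :=
  let '(x, y, z) := p in z = F (sqrt (x ^ 2 + y ^ 2)).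

Definition biLip_embeds (A : R * R * R -> Prop) (L : R) : Prop :=
  exists f : R * R * R -> R * R * R * R,
    forall a b, A a -> A b ->
      / L * dH a b <= dist4 (f a) (f b) /\ dist4 (f a) (f b) <= L * dH a b.

(* Main.v *)
(* In polar coordinates (r, theta) on the surface, put alpha = theta - g r with
   g' t = 2 F' t / t^2, so that the curves alpha = const are horizontal.  Near the origin
   |F' t| <= 2 M t, and the squared Heisenberg distance is comparable, with constants
   depending only on M, to (r - s)^2 + r s |alpha - beta| (angles modulo 2 pi): the surface
   is bi-Lipschitz to the cone over the snowflake (circle, |.|^(1/2)).  That snowflake
   embeds in R^3, so its cone embeds in R^4 by (r, alpha) |-> (r, r Psi alpha).

   Psi runs through four copies, placed on the edges of a square, of a self-similar curve
   which replaces a unit edge by 64 edges of length 1/8 forming a lattice path.  The edges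
   carry thin double cones: those of the smaller edges lie in the one of the large edge,
   those of disjoint edges are apart, and those of consecutive edges leave their common
   vertex in directions separated by an angle.  This is what makes the parametrisation
   bi-Hoelder of exponent 1/2. *)
Require Import Defs.
From Stdlib Require Import Reals.
From Coquelicot Require Import Coquelicot.
From Stdlib Require Import Lra Lia ZArith List Bool Classical.
Import ListNotations.
Open Scope R_scope.

Notation vec := (R * R * R)%type.
Notation zvec := (Z * Z * Z)%type.

(** * A snowflake curve in space *)

Inductive dir := Xp | Xm | Yp | Ym | Zp | Zm.

(** Signed coordinate permutations taking the first axis to [d]: isometries of the sup norm that
    preserve the lattice. Several of them reverse orientation. *)
Definition rot (d : dir) (v : vec) : vec :=
  let '(x, y, z) := v in
  match d with
  | Xp => (x, y, z) | Xm => (- x, - y, - z)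
  | Yp => (y, x, z) | Ym => (- y, - x, - z)
  | Zp => (z, y, x) | Zm => (- z, - y, - x)
  end.

Definition zrot (d : dir) (v : zvec) : zvec :=
  let '(x, y, z) := v in
  match d with
  | Xp => (x, y, z) | Xm => (- x, - y, - z)
  | Yp => (y, x, z) | Ym => (- y, - x, - z)
  | Zp => (z, y, x) | Zm => (- z, - y, - x)
  end%Z.

Definition zadd (p q : zvec) : zvec :=
  let '(a, b, c) := p in let '(a', b', c') := q in (a + a', b + b', c + c')%Z.

Definition step (p : zvec) (d : dir) : zvec := zadd p (zrot d (1, 0, 0)%Z).

Definition place (p : zvec) (d : dir) (v : vec) : vec :=
  let '(a, b, c) := p in let '(x, y, z) := rot d v in (IZR a + x, IZR b + y, IZR c + z).

Definition vscale (k : R) (v : vec) : vec := let '(x, y, z) := v in (k * x, k * y, k * z).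

(** Sup-norm closeness, kept as linear inequalities so that [lra] can work with it directly. *)
Definition within (m : R) (v w : vec) : Prop :=
  let '(x, y, z) := v in let '(x', y', z') := w in
  (- m <= x - x' <= m) /\ (- m <= y - y' <= m) /\ (- m <= z - z' <= m).

(** The double pyramid about the edge from 0 to (1, 0, 0), with square cross-sections of half-width
    3/4 min(x, 1 - x). A slope below 1 keeps the pyramids of two perpendicular edges apart outside
    their common vertex. *)
Definition bicone (v : vec) : Prop :=
  let '(x, y, z) := v in
  (- (3/4 * x) <= y <= 3/4 * x) /\ (- (3/4 * (1 - x)) <= y <= 3/4 * (1 - x)) /\
  (- (3/4 * x) <= z <= 3/4 * x) /\ (- (3/4 * (1 - x)) <= z <= 3/4 * (1 - x)).

Ltac dvec := repeat match goal with v : vec |- _ => destruct v as [[? ?] ?]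
                              | p : zvec |- _ => destruct p as [[? ?] ?] end.

Lemma bicone_fst (v : vec) : bicone v -> 0 <= fst (fst v) <= 1.
Proof. dvec; unfold bicone; simpl; lra. Qed.

Lemma place_within (p : zvec) (d : dir) (m : R) (v w : vec) :
  within m (place p d v) (place p d w) <-> within m v w.
Proof. dvec; destruct d; unfold within, place; simpl; split; lra. Qed.

Lemma within_vscale (k m : R) (v w : vec) : 0 < k ->
  within m (vscale k v) (vscale k w) <-> within (m / k) v w.
Proof.
  intros Hk; dvec; unfold within; simpl.
  assert (Hm : m = k * (m / k)) by (field; lra).
  set (n := m / k) in *; clearbody n; subst m.
  assert (E : forall a b, (- (k * n) <= k * a - k * b <= k * n) <-> (- n <= a - b <= n)).
  { intros a b; split; intros [H1 H2]; split; nra. }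
  rewrite !E; tauto.
Qed.

Lemma within_sym (m : R) (v w : vec) : within m v w -> within m w v.
Proof. dvec; unfold within; lra. Qed.

Lemma within_refl (m : R) (v : vec) : 0 <= m -> within m v v.
Proof. dvec; unfold within; lra. Qed.

Lemma bicone_within (v w : vec) : bicone v -> bicone w -> within 1 v w.
Proof. dvec; unfold within, bicone; lra. Qed.

(** A separation test on integers, decidable by computation: on some axis the projections of the two
    edges are disjoint. *)
Definition far (p : zvec) (d : dir) (q : zvec) (e : dir) : bool :=
  let '(a, b, c) := p in let '(a1, b1, c1) := step p d in
  let '(a', b', c') := q in let '(a1', b1', c1') := step q e in
  let gap x x1 y y1 := ((Z.max x x1 <? Z.min y y1) || (Z.max y y1 <? Z.min x x1))%Z in
  gap a a1 a' a1' || gap b b1 b' b1' || gap c c1 c' c1'.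

(** A bicone leaves the bounding box of its edge by at most 3/8, and disjoint integer intervals are
    at least 1 apart, which leaves 1 - 3/8 - 3/8 = 1/4. *)
Lemma far_correct (p q : zvec) (d e : dir) (v w : vec) (m : R) :
  far p d q e = true -> bicone v -> bicone w ->
  within m (place p d v) (place q e w) -> 1/4 <= m.
Proof.
  intros Hf Hv Hw Hm.
  set (box := fun (l l1 : Z) (x : R) =>
    IZR (Z.min l l1) - 3/8 <= x <= IZR (Z.max l l1) + 3/8).
  assert (Hbox : forall p d v, bicone v ->
    let '(a, b, c) := p in let '(a1, b1, c1) := step p d in
    let '(x, y, z) := place p d v in box a a1 x /\ box b b1 y /\ box c c1 z).
  { clear; intros [[a b] c] d [[x y] z] Hv; unfold bicone in Hv.
    assert (E0 : forall t, Z.min t (t + 0) = t /\ Z.max t (t + 0) = t) by lia.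
    assert (E1 : forall t, Z.min t (t + 1) = t /\ Z.max t (t + 1) = (t + 1)%Z) by lia.
    assert (E2 : forall t, Z.min t (t + -1) = (t - 1)%Z /\ Z.max t (t + -1) = t) by lia.
    destruct d; simpl; unfold box; simpl;
      rewrite ?(fun t => proj1 (E0 t)), ?(fun t => proj2 (E0 t)),
        ?(fun t => proj1 (E1 t)), ?(fun t => proj2 (E1 t)),
        ?(fun t => proj1 (E2 t)), ?(fun t => proj2 (E2 t)), ?plus_IZR, ?minus_IZR; lra. }
  assert (Hgap : forall x x1 y y1 s t, box x x1 s -> box y y1 t -> - m <= s - t <= m ->
    ((Z.max x x1 <? Z.min y y1) || (Z.max y y1 <? Z.min x x1))%Z = true -> 1/4 <= m).
  { clear; unfold box; intros x x1 y y1 s t Hs Ht Hst H.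
    apply orb_true_iff in H; rewrite !Z.ltb_lt in H.
    destruct H as [H|H]; apply Zlt_le_succ, IZR_le in H;
      unfold Z.succ in H; rewrite plus_IZR in H; lra. }
  pose proof (Hbox p d v Hv) as B1; pose proof (Hbox q e w Hw) as B2; clear Hbox Hv Hw.
  unfold far in Hf.
  destruct p as [[a b] c], q as [[a' b'] c'].
  destruct (step (a, b, c) d) as [[a1 b1] c1], (step (a', b', c') e) as [[a1' b1'] c1'].
  destruct (place (a, b, c) d v) as [[x y] z], (place (a', b', c') e w) as [[x' y'] z'].
  destruct B1 as (? & ? & ?), B2 as (? & ? & ?), Hm as (? & ? & ?).
  cbv beta zeta in Hf; apply orb_true_iff in Hf; destruct Hf as [Hf|Hf];
    [apply orb_true_iff in Hf; destruct Hf as [Hf|Hf]|]; eauto.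
Qed.

Definition opposite (d e : dir) : bool :=
  match d, e with
  | Xp, Xm | Xm, Xp | Yp, Ym | Ym, Yp | Zp, Zm | Zm, Zp => true
  | _, _ => false
  end.

(** Let a and b be the axial distances of the two points to the common vertex. For perpendicular
    edges the coordinates along them differ by at least a - 3/4 b and b - 3/4 a, whose sum is (a +
    b)/4; hence the factor 8. *)
Lemma joint_lower (p : zvec) (d e : dir) (v w : vec) (m : R) :
  opposite d e = false -> bicone v -> bicone w ->
  within m (place p d v) (place (step p d) e w) ->
  (1 - fst (fst v)) + fst (fst w) <= 8 * m.
Proof.
  intros Ho Hv Hw Hm; dvec.
  unfold bicone in *; simpl.
  destruct d, e; try discriminate Ho; unfold within in Hm; simpl in Hm;
    rewrite ?plus_IZR in Hm; lra.
Qed.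

(** As the slope is at most 1, the sup-norm distance from a point of a bicone to an apex is its
    axial distance, so this is the triangle inequality through the common vertex. *)
Lemma joint_upper (p : zvec) (d e : dir) (v w : vec) (m : R) :
  bicone v -> bicone w -> (1 - fst (fst v)) + fst (fst w) <= m ->
  within m (place p d v) (place (step p d) e w).
Proof.
  intros Hv Hw Hm; dvec.
  unfold bicone in *; simpl in Hm.
  destruct d, e; unfold within; simpl; rewrite ?plus_IZR; lra.
Qed.

Definition in_bicone8 (w : zvec) : bool :=
  let '(x, y, z) := w in
  (let m := Z.min (3 * x) (3 * (64 - x)) in
  (4 * Z.abs y <=? m) && (4 * Z.abs z <=? m))%Z.

(* Lengths are multiplied by 8 to keep the corners of the bicone integral: the target,
   8 times the bicone, becomes 64 long. *)
Definition fits (p : zvec) (d : dir) : bool :=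
  let '(a, b, c) := p in
  forallb (fun v => in_bicone8 (zadd (8 * a, 8 * b, 8 * c)%Z (zrot d v)))
    [(0, 0, 0); (8, 0, 0); (4, 3, 3); (4, 3, -3); (4, -3, 3); (4, -3, -3)]%Z.

Lemma in_bicone8_correct (x y z : Z) : in_bicone8 (x, y, z) = true ->
  (- (3/4 * IZR x) <= IZR y <= 3/4 * IZR x) /\
  (- (3/4 * (64 - IZR x)) <= IZR y <= 3/4 * (64 - IZR x)) /\
  (- (3/4 * IZR x) <= IZR z <= 3/4 * IZR x) /\
  (- (3/4 * (64 - IZR x)) <= IZR z <= 3/4 * (64 - IZR x)).
Proof.
  unfold in_bicone8; rewrite andb_true_iff, !Z.leb_le; intros [H1 H2].
  assert (E : (4 * y <= 3 * x /\ -(4 * y) <= 3 * x /\ 4 * y <= 3 * (64 - x) /\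
    -(4 * y) <= 3 * (64 - x) /\ 4 * z <= 3 * x /\ -(4 * z) <= 3 * x /\
    4 * z <= 3 * (64 - x) /\ -(4 * z) <= 3 * (64 - x))%Z) by lia.
  destruct E as (E1 & E2 & E3 & E4 & E5 & E6 & E7 & E8).
  apply IZR_le in E1, E2, E3, E4, E5, E6, E7, E8.
  rewrite ?opp_IZR, ?mult_IZR, ?minus_IZR in *; lra.
Qed.

(** A bicone is the convex hull of its six corners and the target is cut out by linear inequalities,
    so testing the corners suffices. *)
Lemma fits_correct (p : zvec) (d : dir) (v : vec) :
  fits p d = true -> bicone v -> bicone (vscale (/8) (place p d v)).
Proof.
  intros Hf Hv; dvec; unfold fits in Hf.
  cbv [forallb zadd] in Hf; rewrite !andb_true_iff in Hf.
  destruct Hf as (H1 & H2 & H3 & H4 & H5 & H6 & _).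
  destruct d; cbv [zrot] in *;
    apply in_bicone8_correct in H1, H2, H3, H4, H5, H6;
    rewrite ?plus_IZR, ?mult_IZR in *; unfold bicone in *; simpl in *;
    cbv [Z.opp] in *;
    repeat match goal with H : _ /\ _ |- _ => destruct H end; repeat split; lra.
Qed.

(* Found by computer search: a self-avoiding lattice path of 64 edges from 0 to (8, 0, 0)
   inside 8 times the bicone, starting and ending along its axis. *)
Definition pattern : list dir :=
  [Xp; Xp; Ym; Xp; Ym; Xp; Xp; Yp; Xm; Yp; Xm; Yp; Yp; Xp; Ym; Zm;
   Xm; Yp; Xp; Xp; Ym; Zm; Xm; Ym; Xm; Zp; Ym; Zm; Xp; Xp; Zp; Ym;
   Xm; Yp; Yp; Xp; Zp; Yp; Zp; Yp; Xm; Xm; Ym; Zp; Xp; Zm; Ym; Ym;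
   Ym; Xp; Yp; Zp; Xm; Xm; Zm; Yp; Zp; Xp; Xp; Zm; Xp; Zm; Xp; Xp].

Definition heading (i : nat) : dir := nth i pattern Xp.
Definition vertex (i : nat) : zvec := fold_left step (firstn i pattern) (0, 0, 0)%Z.

Lemma vertex_S (i : nat) : (i < 64)%nat -> vertex (S i) = step (vertex i) (heading i).
Proof.
  intros Hi; unfold vertex, heading.
  assert (E : firstn (S i) pattern = firstn i pattern ++ [nth i pattern Xp]).
  { clear -Hi; change 64%nat with (length pattern) in Hi; revert i Hi.
    induction pattern as [|d l IH]; intros [|i] Hi; simpl in *; try lia; auto.
    now rewrite (IH i) by lia. }
  rewrite E, fold_left_app; reflexivity.
Qed.

(** For i = 63 the next heading is the default [Xp] of [nth], which agrees with the last edge of the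
    path. *)
Lemma pattern_check_edges :
  forallb (fun i => fits (vertex i) (heading i) && negb (opposite (heading i) (heading (S i))))
    (seq 0 64) = true.
Proof. vm_compute; reflexivity. Qed.

(** The range [seq 0 (j - 1)] stops just before the predecessor of edge j, which shares a vertex
    with it. *)
Lemma pattern_check_far :
  forallb (fun j => forallb (fun i => far (vertex i) (heading i) (vertex j) (heading j))
    (seq 0 (j - 1))) (seq 0 64) = true.
Proof. vm_compute; reflexivity. Qed.

Lemma pattern_fits (i : nat) : (i < 64)%nat -> fits (vertex i) (heading i) = true.
Proof.
  intros Hi; pose proof pattern_check_edges as H; rewrite forallb_forall in H.
  specialize (H i ltac:(apply in_seq; lia)); now apply andb_true_iff in H.
Qed.

Lemma pattern_turns (i : nat) : (i < 64)%nat -> opposite (heading i) (heading (S i)) = false.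
Proof.
  intros Hi; pose proof pattern_check_edges as H; rewrite forallb_forall in H.
  specialize (H i ltac:(apply in_seq; lia)); apply andb_true_iff in H.
  now apply negb_true_iff.
Qed.

Lemma pattern_far (i j : nat) : (S i < j < 64)%nat ->
  far (vertex i) (heading i) (vertex j) (heading j) = true.
Proof.
  intros Hi; pose proof pattern_check_far as H; rewrite forallb_forall in H.
  specialize (H j ltac:(apply in_seq; lia)); rewrite forallb_forall in H.
  exact (H i ltac:(apply in_seq; lia)).
Qed.

(** * The self-similar curve as a limit of approximations *)

Definition digit (t : R) : nat := Nat.min 63 (Z.to_nat (Int_part (64 * t))).
Definition shift (t : R) : R := 64 * t - INR (digit t).

Lemma digit_lt (t : R) : (digit t < 64)%nat.
Proof. unfold digit; lia. Qed.

Lemma shift_range (t : R) : 0 <= t <= 1 -> 0 <= shift t <= 1.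
Proof.
  intros Ht; unfold shift, digit.
  destruct (base_Int_part (64 * t)) as [H1 H2].
  set (k := Int_part (64 * t)) in *.
  assert (Hk : (0 <= k)%Z) by (apply Z.lt_succ_r, lt_IZR; rewrite succ_IZR; simpl; lra).
  destruct (Nat.le_gt_cases (Z.to_nat k) 63) as [Hle|Hgt].
  - rewrite Nat.min_r by lia; rewrite INR_IZR_INZ, Z2Nat.id by lia; lra.
  (* Only t = 1 arrives here; the cap at 63 puts it at the end of the last piece, with shift 1. *)
  - rewrite Nat.min_l by lia; assert (H64 : (64 <= k)%Z) by lia.
    apply IZR_le in H64; rewrite INR_IZR_INZ; simpl; lra.
Qed.

(** Parameters are magnified by 64 and space by 8 = sqrt 64: this ratio is the source of the
    exponent 1/2. *)
Definition refine (t : R) (v : vec) : vec :=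
  vscale (/8) (place (vertex (digit t)) (heading (digit t)) v).

Lemma refine_bicone (t : R) (v : vec) : bicone v -> bicone (refine t v).
Proof. apply fits_correct, pattern_fits, digit_lt. Qed.

Lemma refine_within (t m : R) (v w : vec) :
  within m (refine t v) (refine t w) <-> within (8 * m) v w.
Proof.
  unfold refine; rewrite within_vscale, place_within by lra.
  replace (m / / 8) with (8 * m) by field; tauto.
Qed.

Fixpoint approx (n : nat) (t : R) : vec :=
  match n with
  | O => (t, 0, 0)
  | S n => refine t (approx n (shift t))
  end.

Lemma approx_bicone (n : nat) (t : R) : 0 <= t <= 1 -> bicone (approx n t).
Proof.
  revert t; induction n as [|n IH]; intros t Ht; simpl.
  - lra.
  - now apply refine_bicone, IH, shift_range.
Qed.

(** At level 0 both points lie in the bicone, of sup-norm diameter 1; each further level contracts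
    by 8. *)
Lemma approx_cauchy (n k : nat) (t : R) : 0 <= t <= 1 ->
  within ((1/8) ^ n) (approx n t) (approx (n + k) t).
Proof.
  revert t; induction n as [|n IH]; intros t Ht.
  - apply bicone_within; now apply approx_bicone.
  - simpl; apply refine_within.
    replace (8 * (1 / 8 * (1 / 8) ^ n)) with ((1/8) ^ n) by field.
    now apply IH, shift_range.
Qed.

Definition curve (t : R) : vec :=
  (real (Lim_seq (fun n => fst (fst (approx n t)))),
   real (Lim_seq (fun n => snd (fst (approx n t)))),
   real (Lim_seq (fun n => snd (approx n t)))).

Lemma eighth_pow_small (e : R) : 0 < e -> exists n, (1/8) ^ n < e.
Proof.
  intros He; destruct (pow_lt_1_zero (1/8) ltac:(rewrite Rabs_pos_eq; lra) e He) as [N HN].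
  exists N; specialize (HN N (le_n N)); rewrite Rabs_pos_eq in HN; [lra|].
  apply pow_le; lra.
Qed.

Lemma le_of_eighth_pow (a b : R) : (forall n, a <= b + 4 * (1/8) ^ n) -> a <= b.
Proof.
  intros H; apply Rnot_lt_le; intros Hlt.
  destruct (eighth_pow_small ((a - b) / 4) ltac:(lra)) as [n Hn].
  specialize (H n); lra.
Qed.

Lemma Lim_seq_geometric (u : nat -> R) :
  (forall n k, - (1/8) ^ n <= u n - u (n + k)%nat <= (1/8) ^ n) ->
  forall n, - (1/8) ^ n <= u n - real (Lim_seq u) <= (1/8) ^ n.
Proof.
  intros Hu n.
  assert (Hc : ex_finite_lim_seq u).
  { apply ex_lim_seq_cauchy_corr; intros e.
    destruct (eighth_pow_small (e / 2) ltac:(destruct e; simpl; lra)) as [N HN].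
    exists N; intros i j Hi Hj.
    pose proof (Hu N (i - N)%nat) as H1; pose proof (Hu N (j - N)%nat) as H2.
    replace (N + (i - N))%nat with i in H1 by lia.
    replace (N + (j - N))%nat with j in H2 by lia.
    apply Rabs_def1; lra. }
  apply Lim_seq_correct' in Hc.
  assert (Hs : is_lim_seq (fun k => u (n + k)%nat) (real (Lim_seq u))).
  { apply is_lim_seq_ext with (fun k => u (k + n)%nat); [intros k; f_equal; lia|].
    now apply (is_lim_seq_incr_n u n). }
  assert (E1 : Rbar_le (u n - (1/8) ^ n) (real (Lim_seq u))).
  { apply is_lim_seq_le with (fun _ => u n - (1/8) ^ n) (fun k => u (n + k)%nat).
    - intros k; specialize (Hu n k); lra.
    - apply is_lim_seq_const.
    - exact Hs. }
  assert (E2 : Rbar_le (real (Lim_seq u)) (u n + (1/8) ^ n)).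
  { apply is_lim_seq_le with (fun k => u (n + k)%nat) (fun _ => u n + (1/8) ^ n).
    - intros k; specialize (Hu n k); lra.
    - exact Hs.
    - apply is_lim_seq_const. }
  simpl in E1, E2; lra.
Qed.

Lemma curve_approx (n : nat) (t : R) : 0 <= t <= 1 -> within ((1/8) ^ n) (approx n t) (curve t).
Proof.
  intros Ht.
  assert (H : forall n k, within ((1/8) ^ n) (approx n t) (approx (n + k) t))
    by (intros; now apply approx_cauchy).
  pose proof (Lim_seq_geometric (fun n => fst (fst (approx n t)))) as H1.
  pose proof (Lim_seq_geometric (fun n => snd (fst (approx n t)))) as H2.
  pose proof (Lim_seq_geometric (fun n => snd (approx n t))) as H3.
  specialize (H1 ltac:(intros i j; specialize (H i j); cbv beta; destruct (approx i t) as [[? ?] ?],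
    (approx (i + j) t) as [[? ?] ?]; apply H) n).
  specialize (H2 ltac:(intros i j; specialize (H i j); cbv beta; destruct (approx i t) as [[? ?] ?],
    (approx (i + j) t) as [[? ?] ?]; apply H) n).
  specialize (H3 ltac:(intros i j; specialize (H i j); cbv beta; destruct (approx i t) as [[? ?] ?],
    (approx (i + j) t) as [[? ?] ?]; apply H) n).
  unfold curve; revert H1 H2 H3; cbv beta; destruct (approx n t) as [[? ?] ?]; intros H1 H2 H3.
  exact (conj H1 (conj H2 H3)).
Qed.

Lemma curve_bicone (t : R) : 0 <= t <= 1 -> bicone (curve t).
Proof.
  intros Ht.
  assert (H : forall n, within ((1/8) ^ n) (approx n t) (curve t) /\ bicone (approx n t))
    by (split; [now apply curve_approx | now apply approx_bicone]).
  destruct (curve t) as [[x y] z]; unfold bicone; repeat split;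
    apply le_of_eighth_pow; intros n; specialize (H n); unfold within, bicone in H;
    destruct (approx n t) as [[x' y'] z']; lra.
Qed.

Lemma within_eq (v w : vec) : (forall n, within (4 * (1/8) ^ n) v w) -> v = w.
Proof.
  intros H; dvec; f_equal; [f_equal|]; apply Rle_antisym; apply le_of_eighth_pow;
    intros n; specialize (H n); unfold within in H; lra.
Qed.

Lemma within_trans (m m' : R) (u v w : vec) :
  within m u v -> within m' v w -> within (m + m') u w.
Proof. dvec; unfold within; lra. Qed.

Lemma within_le (m m' : R) (u v : vec) : m <= m' -> within m u v -> within m' u v.
Proof. dvec; unfold within; lra. Qed.

(** The recursion for [approx] passes to the limit: both sides are within (1/8)^(n+1) of
    [approx (S n) t], for every n. *)
Lemma curve_refine (t : R) : 0 <= t <= 1 -> curve t = refine t (curve (shift t)).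
Proof.
  intros Ht; apply within_eq; intros n.
  assert (Hp : 0 <= (1/8) ^ n) by (apply pow_le; lra).
  apply within_le with ((1/8) ^ S n + (1/8) ^ S n); [simpl; lra|].
  apply within_trans with (approx (S n) t).
  - now apply within_sym, curve_approx.
  - simpl; apply refine_within.
    replace (8 * (1 / 8 * (1 / 8) ^ n)) with ((1/8) ^ n) by field.
    now apply curve_approx, shift_range.
Qed.

(** * Distance from the curve to its endpoints *)

Lemma pow64_inv_small (t : R) : 0 < t -> exists n, / 64 ^ n <= t.
Proof.
  intros Ht; destruct (eighth_pow_small t Ht) as [n Hn]; exists n.
  apply Rle_trans with ((1/8) ^ n); [|lra].
  replace (1/8) with (/8) by field; rewrite pow_inv.
  apply Rinv_le_contravar; [apply pow_lt; lra|].
  apply pow_incr; lra.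
Qed.

(** Inside the bicone this is the sup-norm distance to the starting point, and its complement to 1
    is the distance to the endpoint. *)
Definition abscissa (t : R) : R := fst (fst (curve t)).

Lemma abscissa_range (t : R) : 0 <= t <= 1 -> 0 <= abscissa t <= 1.
Proof. intros Ht; now apply bicone_fst, curve_bicone. Qed.

Lemma abscissa_first (t : R) : 0 <= t <= 1 -> digit t = 0%nat ->
  abscissa t = abscissa (64 * t) / 8 /\ 0 <= 64 * t <= 1.
Proof.
  intros Ht Hd; pose proof (shift_range t Ht) as Hs; unfold shift in Hs.
  unfold abscissa; rewrite (curve_refine t Ht); unfold refine, shift.
  rewrite Hd in *; simpl INR in *; rewrite Rminus_0_r in *.
  destruct (curve (64 * t)) as [[x y] z]; simpl; split; [field|exact Hs].
Qed.

Lemma abscissa_last (t : R) : 0 <= t <= 1 -> digit t = 63%nat ->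
  1 - abscissa t = (1 - abscissa (64 * t - 63)) / 8 /\ 0 <= 64 * t - 63 <= 1.
Proof.
  intros Ht Hd; pose proof (shift_range t Ht) as Hs; unfold shift in Hs.
  unfold abscissa; rewrite (curve_refine t Ht); unfold refine, shift.
  rewrite Hd in *; replace (INR 63) with 63 in * by (simpl; ring).
  replace (vertex 63) with (7, 0, 0)%Z by (vm_compute; reflexivity).
  change (heading 63) with Xp.
  destruct (curve (64 * t - 63)) as [[x y] z]; cbn [vscale place rot fst snd].
  split; [field|exact Hs].
Qed.

Definition fst_between (l h : Z) (p : zvec) (d : dir) : bool :=
  let '(a, _, _) := p in let '(a', _, _) := step p d in
  ((l <=? Z.min a a') && (Z.max a a' <=? h))%Z.

(** Only the first edge enters the slab between 0 and 1 on the axis, and only the last one the slab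
    between 7 and 8; the other pieces thus stay away from the two endpoints. *)
Lemma pattern_check_ends :
  forallb (fun i => ((i =? 0)%nat || fst_between 1 8 (vertex i) (heading i)) &&
                    ((i =? 63)%nat || fst_between 0 7 (vertex i) (heading i))) (seq 0 64) = true.
Proof. vm_compute; reflexivity. Qed.

Lemma abscissa_middle (t : R) : 0 <= t <= 1 ->
  (digit t <> 0%nat -> 1/16 <= abscissa t) /\ (digit t <> 63%nat -> 1/16 <= 1 - abscissa t).
Proof.
  intros Ht; pose proof pattern_check_ends as H; rewrite forallb_forall in H.
  pose proof (digit_lt t) as Hd.
  specialize (H (digit t) ltac:(apply in_seq; lia)).
  apply andb_true_iff in H; destruct H as [H1 H2]; rewrite orb_true_iff, Nat.eqb_eq in H1, H2.
  assert (E : forall l h, fst_between l h (vertex (digit t)) (heading (digit t)) = true ->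
    IZR l - 3/8 <= 8 * abscissa t <= IZR h + 3/8).
  { intros l h; unfold abscissa; rewrite (curve_refine t Ht); unfold refine.
    pose proof (curve_bicone _ (shift_range t Ht)) as Hb.
    destruct (curve (shift t)) as [[x y] z], (vertex (digit t)) as [[a b] c].
    unfold bicone in Hb; clear -Hb.
    unfold fst_between; destruct (heading (digit t)); simpl;
      rewrite andb_true_iff, !Z.leb_le; intros [E1 E2].
    1: assert (l <= a /\ a + 1 <= h)%Z as [F1 F2] by lia.
    2: assert (l + 1 <= a /\ a <= h)%Z as [F1 F2] by lia.
    3-6: assert (l <= a /\ a <= h)%Z as [F1 F2] by lia.
    all: apply IZR_le in F1, F2; rewrite ?plus_IZR in *; lra. }
  split; intros Hn.
  - destruct H1 as [H1|H1]; [easy|]; specialize (E _ _ H1); lra.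
  - destruct H2 as [H2|H2]; [easy|]; specialize (E _ _ H2); lra.
Qed.

Lemma digit_first (t : R) : 0 <= t <= 1 -> digit t <> 0%nat -> 1/64 <= t.
Proof.
  intros Ht Hd; pose proof (shift_range t Ht) as Hs; unfold shift in Hs.
  assert (H : (1 <= digit t)%nat) by lia; apply le_INR in H; simpl in H; lra.
Qed.

Lemma digit_last (t : R) : 0 <= t <= 1 -> digit t <> 63%nat -> 1/64 <= 1 - t.
Proof.
  intros Ht Hd; pose proof (shift_range t Ht) as Hs; unfold shift in Hs.
  pose proof (digit_lt t).
  assert (H1 : (digit t <= 62)%nat) by lia; apply le_INR in H1.
  replace (INR 62) with 62 in H1 by (simpl; ring); lra.
Qed.

(** Zooming into the first piece multiplies t by 64 and the abscissa by 8, so t / abscissa^2 is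
    unchanged. Once t has left the first piece, t lies in [1/64, 1] and the abscissa in [1/16, 1],
    whence 256 = 16^2 and 64. *)
Lemma abscissa_bounds (t : R) : 0 <= t <= 1 ->
  t <= 256 * abscissa t ^ 2 /\ abscissa t ^ 2 <= 64 * t.
Proof.
  intros Ht; destruct (proj1 Ht) as [Hpos|<-].
  - destruct (pow64_inv_small t Hpos) as [n Hn]; revert t Ht Hpos Hn.
    induction n as [|n IH]; intros t Ht Hpos Hn; pose proof (abscissa_range t Ht) as Ha;
      (destruct (Nat.eq_dec (digit t) 0) as [Hd|Hd];
        [|pose proof (digit_first t Ht Hd); pose proof (proj1 (abscissa_middle t Ht) Hd); nra]).
    + destruct (abscissa_first t Ht Hd) as [_ H]; simpl in Hn; lra.
    + destruct (abscissa_first t Ht Hd) as [E H].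
      assert (Hn' : / 64 ^ n <= 64 * t).
      { replace (/ 64 ^ n) with (64 * / 64 ^ S n) by (simpl; field; apply pow_nonzero; lra); lra. }
      specialize (IH (64 * t) H ltac:(lra) Hn'); rewrite E; lra.
  - assert (Hd : digit 0 = 0%nat).
    { destruct (Nat.eq_dec (digit 0) 0) as [Hd|Hd]; [easy|].
      pose proof (digit_first 0 Ht Hd); lra. }
    destruct (abscissa_first 0 Ht Hd) as [E _].
    rewrite Rmult_0_r in E; replace (abscissa 0) with 0 by lra; lra.
Qed.

Lemma coabscissa_bounds (t : R) : 0 <= t <= 1 ->
  1 - t <= 256 * (1 - abscissa t) ^ 2 /\ (1 - abscissa t) ^ 2 <= 64 * (1 - t).
Proof.
  intros Ht; destruct (proj2 Ht) as [Hpos| ->].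
  - destruct (pow64_inv_small (1 - t) ltac:(lra)) as [n Hn]; revert t Ht Hpos Hn.
    induction n as [|n IH]; intros t Ht Hpos Hn; pose proof (abscissa_range t Ht) as Ha;
      (destruct (Nat.eq_dec (digit t) 63) as [Hd|Hd];
        [|pose proof (digit_last t Ht Hd); pose proof (proj2 (abscissa_middle t Ht) Hd); nra]).
    + destruct (abscissa_last t Ht Hd) as [_ H]; simpl in Hn; lra.
    + destruct (abscissa_last t Ht Hd) as [E H].
      assert (Hn' : / 64 ^ n <= 1 - (64 * t - 63)).
      { replace (/ 64 ^ n) with (64 * / 64 ^ S n) by (simpl; field; apply pow_nonzero; lra); lra. }
      specialize (IH (64 * t - 63) H ltac:(lra) Hn'); rewrite E; lra.
  - assert (Hd : digit 1 = 63%nat).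
    { destruct (Nat.eq_dec (digit 1) 63) as [Hd|Hd]; [easy|].
      pose proof (digit_last 1 Ht Hd); lra. }
    destruct (abscissa_last 1 Ht Hd) as [E _].
    replace (64 * 1 - 63) with 1 in E by ring; replace (1 - abscissa 1) with 0 by lra; lra.
Qed.

(** With a and b the axial distances to the vertex, the left side is at most 256 (a^2 + b^2) <= 256
    (a + b)^2, and a + b <= 8 m; this gives 256 * 64 = 2^14. *)
Lemma joint_lower_curve (p : zvec) (d e : dir) (s t m : R) :
  opposite d e = false -> 0 <= s <= 1 -> 0 <= t <= 1 ->
  within m (place p d (curve s)) (place (step p d) e (curve t)) ->
  (1 - s) + t <= 2 ^ 14 * m ^ 2.
Proof.
  intros Ho Hs Ht Hm.
  apply joint_lower in Hm; auto using curve_bicone.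
  change (1 - abscissa s + abscissa t <= 8 * m) in Hm.
  pose proof (coabscissa_bounds s Hs); pose proof (abscissa_bounds t Ht).
  pose proof (abscissa_range s Hs); pose proof (abscissa_range t Ht).
  assert ((1 - abscissa s + abscissa t) ^ 2 <= (8 * m) ^ 2) by (apply pow_incr; lra).
  nra.
Qed.

Lemma joint_upper_curve (p : zvec) (d e : dir) (s t m : R) :
  0 <= s <= 1 -> 0 <= t <= 1 -> 0 <= m -> 128 * ((1 - s) + t) <= m ^ 2 ->
  within m (place p d (curve s)) (place (step p d) e (curve t)).
Proof.
  intros Hs Ht Hm0 Hm; apply joint_upper; auto using curve_bicone.
  change (1 - abscissa s + abscissa t <= m).
  pose proof (coabscissa_bounds s Hs); pose proof (abscissa_bounds t Ht).
  pose proof (abscissa_range s Hs); pose proof (abscissa_range t Ht).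
  apply Rnot_lt_le; intros Hlt.
  pose proof (pow2_ge_0 (1 - abscissa s - abscissa t)).
  assert (m ^ 2 < (1 - abscissa s + abscissa t) ^ 2) by nra.
  lra.
Qed.

(** * Two-sided Hölder bounds of exponent 1/2 *)

Lemma digit_mono (s t : R) : 0 <= s <= 1 -> 0 <= t <= 1 -> s < t -> (digit s <= digit t)%nat.
Proof.
  intros Hs Ht Hst; apply Nat.nlt_ge; intros Hlt.
  apply (le_INR (S _)) in Hlt; rewrite S_INR in Hlt.
  pose proof (shift_range s Hs); pose proof (shift_range t Ht); unfold shift in *; lra.
Qed.

(** The zooming alternative behind both bounds: a common piece, which can be magnified; consecutive
    pieces, which meet at a vertex; or pieces separated by 1/4 before scaling by 1/8. *)
Lemma curve_cases (s t : R) : 0 <= s <= 1 -> 0 <= t <= 1 -> s < t ->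
  (digit s = digit t /\ shift t - shift s = 64 * (t - s) /\
    forall m, within m (curve s) (curve t) <-> within (8 * m) (curve (shift s)) (curve (shift t))) \/
  (digit t = S (digit s) /\ (1 - shift s) + shift t = 64 * (t - s) /\
    forall m, within m (curve s) (curve t) <->
      within (8 * m) (place (vertex (digit s)) (heading (digit s)) (curve (shift s)))
        (place (step (vertex (digit s)) (heading (digit s))) (heading (digit t)) (curve (shift t)))) \/
  (1/64 <= t - s /\ forall m, within m (curve s) (curve t) -> 1/32 <= m).
Proof.
  intros Hs Ht Hst; pose proof (digit_mono s t Hs Ht Hst) as Hd.
  pose proof (shift_range s Hs) as Hs'; pose proof (shift_range t Ht) as Ht'.
  pose proof (digit_lt t) as Hlt.
  assert (E : forall m, within m (curve s) (curve t) <->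
      within (8 * m) (place (vertex (digit s)) (heading (digit s)) (curve (shift s)))
        (place (vertex (digit t)) (heading (digit t)) (curve (shift t)))).
  { intros m; rewrite (curve_refine s), (curve_refine t) by assumption.
    unfold refine; rewrite within_vscale by lra.
    replace (m / / 8) with (8 * m) by field; tauto. }
  destruct (Nat.eq_dec (digit s) (digit t)) as [He|He]; [left|right];
    [|destruct (Nat.eq_dec (digit t) (S (digit s))) as [He'|He']; [left|right]].
  - split; [exact He|]; unfold shift in *; rewrite <- He in *; split; [ring|].
    intros m; now rewrite E, place_within.
  - split; [exact He'|]; split.
    + unfold shift; rewrite He', S_INR; ring.
    + intros m; rewrite E.
      rewrite <- vertex_S, <- He' by apply digit_lt; tauto.
  - split.
    + assert (H : (S (S (digit s)) <= digit t)%nat) by lia.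
      apply le_INR in H; rewrite !S_INR in H; unfold shift in *; lra.
    + intros m Hm; apply E, far_correct in Hm; auto using curve_bicone; [lra|].
      apply pattern_far; lia.
Qed.

(** Magnifying a common piece multiplies t - s by 64 and m^2 by 64, so the inequality is scale
    invariant; since t - s stays at most 1, the zoom ends after finitely many steps in one of the
    two other cases. *)
Lemma curve_lower (s t m : R) : 0 <= s <= 1 -> 0 <= t <= 1 -> s <= t ->
  within m (curve s) (curve t) -> t - s <= 2 ^ 14 * m ^ 2.
Proof.
  intros Hs Ht [Hst| ->] Hm; [|nra].
  destruct (pow64_inv_small (t - s) ltac:(lra)) as [n Hn]; revert s t m Hs Ht Hst Hm Hn.
  induction n as [|n IH]; intros s t m Hs Ht Hst Hm Hn;
  pose proof (shift_range s Hs) as Hs'; pose proof (shift_range t Ht) as Ht';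
  (destruct (curve_cases s t Hs Ht Hst) as [(Hd & E & H)|[(Hd & E & H)|(E & H)]];
    [| |specialize (H m Hm); nra]).
  (* Here t - s >= 1, whereas a common piece forces 64 (t - s) <= 1. *)
  - simpl in Hn; lra.
  - apply H, joint_lower_curve in Hm; auto; [nra|].
    rewrite Hd; apply pattern_turns, digit_lt.
  - apply H, IH in Hm; try lra.
    rewrite E; replace (/ 64 ^ n) with (64 * / 64 ^ S n) by (simpl; field; apply pow_nonzero; lra); lra.
  - apply H, joint_lower_curve in Hm; auto; [nra|].
    rewrite Hd; apply pattern_turns, digit_lt.
Qed.

Lemma curve_upper (s t m : R) : 0 <= s <= 1 -> 0 <= t <= 1 -> s <= t ->
  0 <= m -> 128 * (t - s) <= m ^ 2 -> within m (curve s) (curve t).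
Proof.
  intros Hs Ht [Hst| ->] Hm0 Hm; [|now apply within_refl].
  destruct (pow64_inv_small (t - s) ltac:(lra)) as [n Hn]; revert s t m Hs Ht Hst Hm0 Hm Hn.
  induction n as [|n IH]; intros s t m Hs Ht Hst Hm0 Hm Hn;
  pose proof (shift_range s Hs) as Hs'; pose proof (shift_range t Ht) as Ht';
  (destruct (curve_cases s t Hs Ht Hst) as [(Hd & E & H)|[(Hd & E & H)|(E & H)]];
    (* Separated pieces have t - s >= 1/64, so m^2 >= 2 and m exceeds the diameter of the bicone. *)
    [| |apply within_le with 1; [nra|now apply bicone_within; apply curve_bicone]]).
  - simpl in Hn; lra.
  - apply H, joint_upper_curve; auto; [lra|nra].
  - apply H, IH; try lra.
    rewrite E; replace (/ 64 ^ n) with (64 * / 64 ^ S n) by (simpl; field; apply pow_nonzero; lra); lra.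
  - apply H, joint_upper_curve; auto; [lra|nra].
Qed.

(** * The closed snowflake curve and its cone *)

(** The sides of the unit square are indexed by all integers modulo 4, so that [loop] is defined on
    the whole line and closing up needs no separate case. *)
Definition side (m : Z) : dir :=
  match (m mod 4)%Z with 0 => Xp | 1 => Yp | 2 => Xm | _ => Ym end%Z.
Definition corner (m : Z) : zvec :=
  match (m mod 4)%Z with 0 => (0, 0, 0) | 1 => (1, 0, 0) | 2 => (1, 1, 0) | _ => (0, 1, 0) end%Z.

Lemma mod4_cases (m : Z) :
  (m mod 4 = 0 /\ (m + 1) mod 4 = 1 /\ (m + 2) mod 4 = 2 \/
   m mod 4 = 1 /\ (m + 1) mod 4 = 2 /\ (m + 2) mod 4 = 3 \/
   m mod 4 = 2 /\ (m + 1) mod 4 = 3 /\ (m + 2) mod 4 = 0 \/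
   m mod 4 = 3 /\ (m + 1) mod 4 = 0 /\ (m + 2) mod 4 = 1)%Z.
Proof.
  rewrite (Z.add_mod m 1), (Z.add_mod m 2) by lia.
  pose proof (Z.mod_pos_bound m 4 ltac:(lia)).
  assert (E : (m mod 4 = 0 \/ m mod 4 = 1 \/ m mod 4 = 2 \/ m mod 4 = 3)%Z) by lia.
  destruct E as [-> |[-> |[-> | -> ]]]; simpl; auto 10.
Qed.

Lemma corner_next (m : Z) :
  corner (m + 1) = step (corner m) (side m) /\ opposite (side m) (side (m + 1)) = false.
Proof.
  unfold corner, side; destruct (mod4_cases m) as [(-> & -> & _)|[(-> & -> & _)|
    [(-> & -> & _)|(-> & -> & _)]]]; split; reflexivity.
Qed.

Lemma sides_far (m : Z) : far (corner m) (side m) (corner (m + 2)) (side (m + 2)) = true.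
Proof.
  unfold corner, side; destruct (mod4_cases m) as [(-> & _ & ->)|[(-> & _ & ->)|
    [(-> & _ & ->)|(-> & _ & ->)]]]; reflexivity.
Qed.

Definition loop (u : R) : vec :=
  let m := Int_part (4 * u) in place (corner m) (side m) (curve (4 * u - IZR m)).

Lemma loop_periodic (u : R) (n : Z) : loop (u + IZR n) = loop u.
Proof.
  assert (E : Int_part (4 * (u + IZR n)) = (Int_part (4 * u) + n * 4)%Z).
  { symmetry; apply Int_part_spec; rewrite plus_IZR, mult_IZR.
    destruct (base_Int_part (4 * u)); lra. }
  unfold loop; rewrite E; unfold corner, side; rewrite Z.mod_add by lia.
  do 2 f_equal; rewrite plus_IZR, mult_IZR; ring.
Qed.

Lemma loop_bounded (u : R) : within 2 (loop u) (0, 0, 0).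
Proof.
  unfold loop; set (m := Int_part (4 * u)).
  assert (Hb : bicone (curve (4 * u - IZR m))).
  { apply curve_bicone; subst m; destruct (base_Int_part (4 * u)); lra. }
  destruct (curve (4 * u - IZR m)) as [[x y] z]; unfold bicone in Hb.
  unfold corner, side; destruct (mod4_cases m) as [(-> & _)|[(-> & _)|[(-> & _)|(-> & _)]]];
    unfold within; simpl; lra.
Qed.

Lemma loop_cases (u v : R) : u <= v ->
  let i := Int_part (4 * u) in let s := 4 * u - IZR i in
  exists (k : nat) (t : R), 0 <= s <= 1 /\ 0 <= t <= 1 /\ 4 * (v - u) = INR k + t - s /\
    loop u = place (corner i) (side i) (curve s) /\
    loop v = place (corner (i + Z.of_nat k)) (side (i + Z.of_nat k)) (curve t).
Proof.
  intros Huv i s; set (j := Int_part (4 * v)).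
  destruct (base_Int_part (4 * u)) as [A1 A2], (base_Int_part (4 * v)) as [B1 B2].
  fold i in A1, A2; fold j in B1, B2.
  assert (Hij : (i <= j)%Z) by (apply Z.lt_succ_r, lt_IZR; rewrite succ_IZR; lra).
  exists (Z.to_nat (j - i)), (4 * v - IZR j).
  rewrite INR_IZR_INZ, Z2Nat.id, minus_IZR by lia; unfold s.
  replace (i + (j - i))%Z with j by ring.
  repeat split; try lra.
Qed.

Lemma loop_upper_le (u v m : R) : u <= v -> 0 <= m -> 512 * (v - u) <= m ^ 2 ->
  within m (loop u) (loop v).
Proof.
  intros Huv Hm0 Hm.
  destruct (loop_cases u v Huv) as (k & t & Hs & Ht & E & E1 & E2).
  set (i := Int_part (4 * u)) in *; set (s := 4 * u - IZR i) in *.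
  destruct k as [|[|k]].
  - rewrite Z.add_0_r in E2; rewrite E1, E2; apply place_within.
    simpl in E; apply curve_upper; lra.
  - change (Z.of_nat 1) with 1%Z in E2; rewrite (proj1 (corner_next i)) in E2; rewrite E1, E2.
    simpl in E; apply joint_upper_curve; lra.
  - rewrite !S_INR in E; pose proof (pos_INR k).
    (* Passing at least two corners gives v - u >= 1/4, so m^2 >= 128, and m exceeds the diameter
       bound 4. *)
    apply within_le with (2 + 2); [nra|].
    apply within_trans with (0, 0, 0); [|apply within_sym]; apply loop_bounded.
Qed.

Lemma loop_upper (u v m : R) : 0 <= m -> 512 * Rabs (u - v) <= m ^ 2 ->
  within m (loop u) (loop v).
Proof.
  intros Hm0 Hm; destruct (Rle_dec u v) as [H|H].
  - rewrite Rabs_left1 in Hm by lra; apply loop_upper_le; lra.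
  - rewrite Rabs_pos_eq in Hm by lra; apply within_sym, loop_upper_le; lra.
Qed.

Lemma loop_lower_le (u v m : R) : u <= v <= u + 1/2 ->
  within m (loop u) (loop v) -> v - u <= 2 ^ 14 * m ^ 2.
Proof.
  intros Huv Hm.
  destruct (loop_cases u v (proj1 Huv)) as (k & t & Hs & Ht & E & E1 & E2).
  set (i := Int_part (4 * u)) in *; set (s := 4 * u - IZR i) in *.
  destruct k as [|[|[|k]]].
  - rewrite Z.add_0_r in E2; rewrite E1, E2, place_within in Hm.
    simpl in E; apply curve_lower in Hm; lra.
  - change (Z.of_nat 1) with 1%Z in E2.
    rewrite E1, E2, (proj1 (corner_next i)) in Hm; simpl in E.
    apply joint_lower_curve in Hm; auto; [nra|apply corner_next].
  - change (Z.of_nat 2) with 2%Z in E2.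
    rewrite E1, E2 in Hm; apply far_correct in Hm; auto using curve_bicone, sides_far; nra.
  (* Passing three corners within half a period would force s = 1, but s is a fractional part. *)
  - rewrite !S_INR in E; pose proof (pos_INR k).
    assert (t = 0 /\ s = 1) as [-> Es] by lra.
    exfalso; unfold s in Es; destruct (base_Int_part (4 * u)); fold i in H0, H1; lra.
Qed.

Lemma loop_lower (u v m : R) : Rabs (u - v) <= 1/2 ->
  within m (loop u) (loop v) -> Rabs (u - v) <= 2 ^ 14 * m ^ 2.
Proof.
  intros Huv Hm; destruct (Rle_dec u v) as [H|H].
  - rewrite Rabs_left1 in * by lra; apply loop_lower_le in Hm; lra.
  - rewrite Rabs_pos_eq in * by lra; apply within_sym, loop_lower_le in Hm; lra.
Qed.

(** * The cone over the loop *)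

Definition cone_map (r u : R) : R * R * R * R :=
  let '(a, b, c) := loop u in (r, r * a, r * b, r * c).

Lemma abs_le_sq (a b : R) : 0 <= b -> a ^ 2 <= b ^ 2 -> - b <= a <= b.
Proof. intros Hb H; split; nra. Qed.

Lemma sq_le_abs (a b : R) : - b <= a <= b -> a ^ 2 <= b ^ 2.
Proof. intros H; nra. Qed.

Lemma dist4_sq (p q : R * R * R * R) : dist4 p q ^ 2 =
  (let '(a, b, c, d) := p in let '(a', b', c', d') := q in
   (a - a') ^ 2 + (b - b') ^ 2 + (c - c') ^ 2 + (d - d') ^ 2).
Proof.
  destruct p as [[[a b] c] d], q as [[[a' b'] c'] d']; unfold dist4.
  rewrite pow2_sqrt; [reflexivity|].
  pose proof (pow2_ge_0 (a - a')); pose proof (pow2_ge_0 (b - b'));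
    pose proof (pow2_ge_0 (c - c')); pose proof (pow2_ge_0 (d - d')); lra.
Qed.

Lemma cone_map_upper (r s u v : R) : 0 <= s <= r ->
  dist4 (cone_map r u) (cone_map s v) ^ 2 <= 25 * (r - s) ^ 2 + 3072 * (s ^ 2 * Rabs (u - v)).
Proof.
  intros Hsr; rewrite dist4_sq.
  set (m := sqrt (512 * Rabs (u - v))).
  assert (Hm0 : 0 <= m) by apply sqrt_pos.
  assert (Hm : m ^ 2 = 512 * Rabs (u - v)).
  { apply pow2_sqrt; pose proof (Rabs_pos (u - v)); lra. }
  pose proof (loop_upper u v m Hm0 ltac:(lra)) as Hw.
  pose proof (loop_bounded u) as Hb; unfold cone_map.
  destruct (loop u) as [[a b] c], (loop v) as [[a' b'] c']; unfold within in *.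
  (* Write r x - s x' = (r - s) x + s (x - x') with |x| <= 2. Three such coordinates and the radial
     one give 3 * 8 + 1 = 25 and 6 * 512 = 3072. *)
  assert (E : forall x x', - 2 <= x - 0 <= 2 -> - m <= x - x' <= m ->
    (r * x - s * x') ^ 2 <= 8 * (r - s) ^ 2 + 2 * (s ^ 2 * m ^ 2)).
  { intros x x' H1 H2; apply sq_le_abs in H1, H2; rewrite Rminus_0_r in H1.
    replace (r * x - s * x') with ((r - s) * x + s * (x - x')) by ring.
    pose proof (pow2_ge_0 ((r - s) * x - s * (x - x'))).
    pose proof (Rmult_le_compat_l _ _ _ (pow2_ge_0 (r - s)) H1).
    pose proof (Rmult_le_compat_l _ _ _ (pow2_ge_0 s) H2).
    nra. }
  destruct Hb as (B1 & B2 & B3), Hw as (W1 & W2 & W3).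
  pose proof (E _ _ B1 W1); pose proof (E _ _ B2 W2); pose proof (E _ _ B3 W3).
  rewrite Hm in *; nra.
Qed.

Lemma cone_map_lower_radial (r s u v : R) :
  (r - s) ^ 2 <= dist4 (cone_map r u) (cone_map s v) ^ 2.
Proof.
  rewrite dist4_sq; unfold cone_map.
  destruct (loop u) as [[a b] c], (loop v) as [[a' b'] c'].
  pose proof (pow2_ge_0 (r * a - s * a')); pose proof (pow2_ge_0 (r * b - s * b'));
  pose proof (pow2_ge_0 (r * c - s * c')); lra.
Qed.

Lemma cone_map_lower_angular (r s u v : R) : 0 < s <= r -> Rabs (u - v) <= 1/2 ->
  s ^ 2 * Rabs (u - v) <= 9 * 2 ^ 14 * dist4 (cone_map r u) (cone_map s v) ^ 2.
Proof.
  intros Hsr Huv; pose proof (dist4_sq (cone_map r u) (cone_map s v)) as E.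
  set (n := dist4 (cone_map r u) (cone_map s v)) in *.
  assert (Hn : 0 <= n).
  { unfold n, dist4; destruct (cone_map r u) as [[[? ?] ?] ?], (cone_map s v) as [[[? ?] ?] ?].
    apply sqrt_pos. }
  assert (Hw : within (3 * n / s) (loop u) (loop v)).
  { pose proof (loop_bounded u) as Hb; unfold cone_map in E; clear Huv.
    destruct (loop u) as [[a b] c], (loop v) as [[a' b'] c']; clearbody n.
    pose proof (pow2_ge_0 (r - s)); pose proof (pow2_ge_0 (r * a - s * a'));
    pose proof (pow2_ge_0 (r * b - s * b')); pose proof (pow2_ge_0 (r * c - s * c')).
    pose proof (abs_le_sq (r - s) n Hn ltac:(lra)) as Hr.
    assert (G : forall x x', - 2 <= x - 0 <= 2 -> (r * x - s * x') ^ 2 <= n ^ 2 ->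
      - (3 * n / s) <= x - x' <= 3 * n / s).
    { intros x x' H3 H4; apply abs_le_sq in H4; [|exact Hn].
      (* Since s (x - x') = (r x - s x') - (r - s) x, the bound is n + 2 n. *)
      assert (K : - (3 * n) <= s * (x - x') <= 3 * n) by nra.
      replace (x - x') with (s * (x - x') / s) by (field; lra).
      rewrite <- Rdiv_opp_l; unfold Rdiv; pose proof (Rinv_0_lt_compat s ltac:(lra)).
      split; apply Rmult_le_compat_r; lra. }
    unfold within in *; repeat split; try apply G; lra. }
  apply loop_lower in Hw; [|exact Huv].
  replace (9 * 2 ^ 14 * n ^ 2) with (s ^ 2 * (2 ^ 14 * (3 * n / s) ^ 2)) by (field; lra).
  apply Rmult_le_compat_l; [apply pow2_ge_0|exact Hw].
Qed.

(** * Geometry of the surface *)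

Lemma mean_value_bound (f df : R -> R) (a b K : R) : a <= b ->
  (forall t, a <= t <= b -> is_derive f t (df t)) ->
  (forall t, a <= t <= b -> Rabs (df t) <= K) -> Rabs (f b - f a) <= K * (b - a).
Proof.
  intros Hab Hd HK.
  destruct (MVT_gen f a b df) as (c & Hc & E).
  - intros t Ht; rewrite Rmin_left, Rmax_right in Ht by lra; apply Hd; lra.
  - intros t Ht; rewrite Rmin_left, Rmax_right in Ht by lra.
    apply continuity_pt_filterlim.
    apply (ex_derive_continuous f); exists (df t); apply Hd; lra.
  - rewrite Rmin_left, Rmax_right in Hc by lra.
    rewrite E, Rabs_mult, (Rabs_pos_eq (b - a)) by lra.
    apply Rmult_le_compat_r; [lra|auto].
Qed.

Lemma one_minus_cos (x : R) : 1 - cos x = 2 * sin (x / 2) ^ 2.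
Proof. replace x with (2 * (x / 2)) at 1 by field; rewrite cos_2a_sin; ring. Qed.

Lemma abs_sin_le (x : R) : Rabs (sin x) <= Rabs x.
Proof.
  assert (H : forall y, 0 < y -> Rabs (sin y) <= y).
  { intros y Hy; pose proof (sin_lt_x y Hy); pose proof (SIN_bound y).
    apply Rabs_le; split; [|lra].
    destruct (Rle_dec y 1); [|lra].
    assert (0 <= sin y); [|lra].
    apply sin_ge_0; pose proof PI2_1; lra. }
  destruct (Rtotal_order x 0) as [Hx|[->|Hx]].
  - rewrite <- (Rabs_Ropp x), <- (Rabs_Ropp (sin x)), <- sin_neg.
    rewrite (Rabs_pos_eq (- x)) by lra; apply H; lra.
  - rewrite sin_0; lra.
  - rewrite (Rabs_pos_eq x) by lra; now apply H.
Qed.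

Lemma one_minus_cos_upper (x : R) : 2 * (1 - cos x) <= x ^ 2.
Proof.
  rewrite one_minus_cos; pose proof (abs_sin_le (x / 2)) as H.
  apply (pow_maj_Rabs _ _ 2) in H; rewrite pow2_abs in H; lra.
Qed.

Lemma one_minus_cos_lower (x : R) : Rabs x <= PI -> x ^ 2 <= 18 * (1 - cos x).
Proof.
  intros Hx; rewrite one_minus_cos; pose proof PI_4.
  (* The Taylor polynomial of degree 7 is a lower bound; for y <= 2 its first two terms give at
     least y/3 and the last two a nonnegative amount. *)
  assert (H1 : forall y, 0 <= y <= PI / 2 -> y / 3 <= sin y).
  { intros y Hy; destruct (SIN y ltac:(lra) ltac:(lra)) as [Hs _].
    apply Rle_trans with (2 := Hs); unfold sin_lb, sin_approx, sin_term; simpl.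
    assert (y ^ 2 <= 4) by nra.
    assert (0 <= y ^ 3 * (4 - y ^ 2)) by (apply Rmult_le_pos; [apply pow_le; lra|lra]).
    assert (0 <= y ^ 5 * (4 - y ^ 2)) by (apply Rmult_le_pos; [apply pow_le; lra|lra]).
    assert (0 <= y * (4 - y ^ 2)) by (apply Rmult_le_pos; lra).
    assert (0 <= y ^ 5) by (apply pow_le; lra).
    field_simplify; nra. }
  assert (H2 : (x / 2 / 3) ^ 2 <= sin (x / 2) ^ 2).
  { destruct (Rle_dec 0 x) as [Hp|Hp].
    - rewrite Rabs_pos_eq in Hx by lra; apply pow_incr; split; [lra|apply H1; lra].
    - rewrite Rabs_left1 in Hx by lra; specialize (H1 (- (x / 2)) ltac:(lra)).
      rewrite sin_neg in H1; nra. }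
  lra.
Qed.

(** A quadratic error suffices: replacing sin d by d then costs d^2, which is comparable to the term
    1 - cos d of [heis_sq] for |d| <= pi. *)
Lemma sin_diff_bound (x : R) : Rabs (x - sin x) <= x ^ 2.
Proof.
  assert (H : forall y, 0 <= y -> Rabs (y - sin y) <= y ^ 2).
  { intros y Hy.
    pose proof (mean_value_bound (fun t => t - sin t) (fun t => 1 - cos t) 0 y y Hy) as H.
    cbv beta in H; rewrite sin_0 in H.
    replace (y ^ 2) with (y * (y - 0)) by ring.
    replace (y - sin y) with (y - sin y - (0 - 0)) by ring; apply H.
    - intros t _; auto_derive; [exact I|ring].
    - intros t Ht; rewrite one_minus_cos.
      pose proof (abs_sin_le (t / 2)) as H1; rewrite (Rabs_pos_eq (t / 2)) in H1 by lra.
      pose proof (SIN_bound (t / 2)).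
      rewrite Rabs_pos_eq by (pose proof (pow2_ge_0 (sin (t / 2))); lra).
      rewrite <- pow2_abs; pose proof (Rabs_pos (sin (t / 2))).
      assert (Rabs (sin (t / 2)) <= 1) by (apply Rabs_le; lra); nra. }
  destruct (Rle_dec 0 x) as [Hx|Hx]; [now apply H|].
  specialize (H (- x) ltac:(lra)); rewrite sin_neg in H.
  replace (x - sin x) with (- (- x - - sin x)) by ring; rewrite Rabs_Ropp.
  now replace (x ^ 2) with ((- x) ^ 2) by ring.
Qed.

(** The hypothesis makes the suprema and the limsup finite, so [real] returns its true value. As M
    >= 1, 2 M exceeds the limsup strictly, and some supremum over (0, d) lies below 2 M. *)
Lemma limsup_bound (F' : R -> R) (K : R) :
  (forall t, 0 < t -> 0 <= Rabs (F' t) / t <= K) ->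
  exists eta, 0 < eta /\ forall t, 0 < t < eta -> Rabs (F' t) <= 2 * M_of F' * t.
Proof.
  intros HK; unfold M_of, limsup_right0.
  set (E := fun y : R => exists d, 0 < d /\ _ = _).
  set (V := fun d z => exists t, 0 < t < d /\ z = Rabs (F' t) / t).
  assert (HE : forall y, E y -> 0 <= y).
  { intros y (d & Hd & Hy); pose proof (Lub_Rbar_correct (V d)) as [Hub _].
    fold (V d) in Hy; rewrite <- Hy in Hub.
    assert (Hin : V d (Rabs (F' (d / 2)) / (d / 2))) by (exists (d / 2); split; [lra|reflexivity]).
    apply Hub in Hin; simpl in Hin; specialize (HK (d / 2) ltac:(lra)); lra. }
  assert (HE1 : exists y, E y).
  { pose proof (Lub_Rbar_correct (V 1)) as [Hub Hlub].
    assert (Hin : V 1 (Rabs (F' (1 / 2)) / (1 / 2))) by (exists (1 / 2); split; [lra|reflexivity]).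
    apply Hub in Hin; specialize (Hlub (Finite K)).
    assert (Rbar_le (Lub_Rbar (V 1)) K).
    { apply Hlub; intros z (t & Ht & ->); apply HK; lra. }
    destruct (Lub_Rbar (V 1)) as [y| |] eqn:Hy; try easy.
    exists y, 1; split; [lra|now symmetry]. }
  pose proof (Glb_Rbar_correct E) as [Hlb Hglb].
  assert (Hfin : exists l : R, Glb_Rbar E = l).
  { destruct HE1 as [y Hy]; apply Hlb in Hy.
    assert (H0 : Rbar_le 0 (Glb_Rbar E)) by (apply Hglb; intros z Hz; now apply HE).
    destruct (Glb_Rbar E) as [l| |]; try easy; now exists l. }
  destruct Hfin as [l Hl]; rewrite Hl in *; simpl.
  set (M := Rmax 1 l).
  assert (HM : 1 <= M /\ l <= M) by (split; [apply Rmax_l|apply Rmax_r]).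
  destruct (classic (exists y, E y /\ y < 2 * M)) as [(y & (d & Hd & Hy) & HyM)|Hno].
  - exists d; split; [exact Hd|]; intros t Ht.
    pose proof (Lub_Rbar_correct (V d)) as [Hub _].
    fold (V d) in Hy; rewrite <- Hy in Hub.
    assert (Hin : V d (Rabs (F' t) / t)) by (exists t; split; [lra|reflexivity]).
    apply Hub in Hin; simpl in Hin.
    replace (Rabs (F' t)) with (Rabs (F' t) / t * t) by (field; lra).
    apply Rmult_le_compat_r; lra.
  - exfalso; assert (Rbar_le (2 * M) l); [|simpl in *; lra].
    apply Hglb; intros y Hy; apply Rnot_lt_le; intros Hlt; apply Hno; now exists y.
Qed.

(** Integration starts at 1 because the integrand may grow like 1/t at 0: the horizontal curves may
    spiral infinitely often around the origin. *)
Lemma spiral_exists (F' : R -> R) (K : R) :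
  (forall s t, 0 <= s -> 0 <= t -> Rabs (F' s - F' t) <= K * Rabs (s - t)) ->
  exists g : R -> R, forall t, 0 < t -> is_derive g t (2 * F' t / t ^ 2).
Proof.
  intros HK.
  assert (Hc : forall t, 0 < t -> continuous F' t).
  { intros t Ht; apply continuity_pt_filterlim; intros e He.
    assert (HK1 : 0 < Rabs K + 1) by (pose proof (Rabs_pos K); lra).
    exists (Rmin t (e / (Rabs K + 1))); split.
    - apply Rmin_glb_lt; [exact Ht|now apply Rdiv_lt_0_compat].
    - intros x [_ Hx]; simpl in *; unfold R_dist in *.
      pose proof (Rmin_l t (e / (Rabs K + 1))); pose proof (Rmin_r t (e / (Rabs K + 1))).
      assert (Hx0 : 0 < x) by (apply Rabs_def2 in Hx; lra).
      apply Rle_lt_trans with (K * Rabs (x - t)); [apply HK; lra|].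
      apply Rle_lt_trans with ((Rabs K + 1) * Rabs (x - t)).
      + apply Rmult_le_compat_r; [apply Rabs_pos|pose proof (Rle_abs K); lra].
      + replace e with ((Rabs K + 1) * (e / (Rabs K + 1))) by (field; lra).
        apply Rmult_lt_compat_l; lra. }
  set (h := fun t => 2 * F' t / t ^ 2).
  assert (Hh : forall t, 0 < t -> continuous h t).
  { intros t Ht; unfold h, Rdiv.
    apply (continuous_mult (fun t => 2 * F' t) (fun t => / t ^ 2)).
    - apply (continuous_mult (fun _ => 2) F'); [apply continuous_const|auto].
    - apply (ex_derive_continuous (fun t => / t ^ 2)); auto_derive.
      apply Rgt_not_eq; nra. }
  exists (fun t => RInt h 1 t); intros t Ht; apply (is_derive_RInt h _ 1).
  - exists (mkposreal t Ht); intros y Hy; apply (RInt_correct h 1 y), (ex_RInt_continuous h).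
    apply Rabs_def2 in Hy; simpl in Hy; unfold minus, plus, opp in Hy; simpl in Hy.
    intros z Hz; apply Hh; apply Rlt_le_trans with (2 := proj1 Hz); apply Rmin_glb_lt; lra.
  - now apply Hh.
Qed.

Lemma Int_nearest (x : R) : exists n : Z, Rabs (x + IZR n) <= 1 / 2.
Proof.
  destruct (base_Int_part (x + 1 / 2)) as [H1 H2].
  exists (- Int_part (x + 1 / 2))%Z; rewrite opp_IZR; apply Rabs_le; lra.
Qed.

Lemma sin_cos_periodic (x : R) (n : Z) :
  sin (x + 2 * PI * IZR n) = sin x /\ cos (x + 2 * PI * IZR n) = cos x.
Proof.
  assert (H : forall y k, sin (y + 2 * PI * INR k) = sin y /\ cos (y + 2 * PI * INR k) = cos y).
  { intros y k; replace (y + 2 * PI * INR k) with (y + 2 * INR k * PI) by ring.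
    split; [apply sin_period|apply cos_period]. }
  destruct (Z_le_gt_dec 0 n) as [Hn|Hn].
  - rewrite <- (Z2Nat.id n), <- INR_IZR_INZ by lia; apply H.
  - destruct (H (x + 2 * PI * IZR n) (Z.to_nat (- n))) as [<- <-].
    rewrite INR_IZR_INZ, Z2Nat.id, opp_IZR by lia; split; f_equal; ring.
Qed.

(** * Comparison of the Heisenberg distance with the cone *)

Section Profile.

Variables (F F' g : R -> R) (M eta : R).
Hypothesis HM : 1 <= M.
Hypothesis HF : forall t, 0 < t -> is_derive F t (F' t).
Hypothesis HF0 : filterlim (fun h => (F h - F 0) / h) (at_right 0) (locally 0).
Hypothesis HF' : forall t, 0 < t < eta -> Rabs (F' t) <= 2 * M * t.
Hypothesis Hg : forall t, 0 < t -> is_derive g t (2 * F' t / t ^ 2).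

Lemma profile_increment_pos (s r : R) : 0 < s <= r -> r < eta ->
  Rabs (F r - F s) <= 2 * M * r * (r - s).
Proof.
  intros Hs Hr; apply mean_value_bound with F'; [lra|intros; apply HF; lra|].
  intros t Ht; apply Rle_trans with (2 * M * t); [apply HF'; lra|nra].
Qed.

(** For s = 0 the bound is obtained from a small h > 0: the vanishing right derivative gives |F h -
    F 0| <= h, an arbitrarily small error. *)
Lemma profile_increment (s r : R) : 0 <= s <= r -> r < eta ->
  Rabs (F r - F s) <= 2 * M * r * (r - s).
Proof.
  intros [[Hs|<-] Hsr] Hr; [now apply profile_increment_pos|].
  destruct Hsr as [Hr0|<-].
  2:{ unfold Rminus; rewrite !Rplus_opp_r, Rabs_R0; lra. }
  apply le_epsilon; intros e He.
  destruct (HF0 (ball 0 1)) as [d Hd].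
  { exists (mkposreal 1 Rlt_0_1); auto. }
  set (h := Rmin (d / 2) (Rmin r e)).
  assert (Hh : 0 < h) by (repeat apply Rmin_glb_lt; destruct d; simpl; lra).
  assert (Hhr : h <= r) by (unfold h; rewrite Rmin_r; apply Rmin_l).
  assert (Hhe : h <= e) by (unfold h; rewrite Rmin_r; apply Rmin_r).
  assert (Hhd : h <= d / 2) by apply Rmin_l.
  assert (Hb : Rabs (F h - F 0) <= h).
  { assert (Hq : ball 0 1 ((F h - F 0) / h)).
    { apply Hd; [|exact Hh]; change (Rabs (h - 0) < d).
      rewrite Rabs_pos_eq; destruct d; simpl in *; lra. }
    change (Rabs ((F h - F 0) / h - 0) < 1) in Hq; rewrite Rminus_0_r in Hq.
    replace (F h - F 0) with ((F h - F 0) / h * h) by (field; lra).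
    rewrite Rabs_mult, (Rabs_pos_eq h) by lra; nra. }
  replace (F r - F 0) with ((F r - F h) + (F h - F 0)) by ring.
  apply Rle_trans with (1 := Rabs_triang _ _).
  pose proof (profile_increment_pos h r ltac:(lra) Hr) as H1.
  assert (2 * M * r * (r - h) <= 2 * M * r * (r - 0)); [|lra].
  apply Rmult_le_compat_l; [|lra]; apply Rmult_le_pos; lra.
Qed.

Lemma spiral_increment (s r : R) : 0 < s <= r -> r < eta ->
  Rabs (g r - g s) <= 4 * M * ((r - s) / s).
Proof.
  intros Hs Hr; replace (4 * M * ((r - s) / s)) with (4 * M / s * (r - s)) by (field; lra).
  apply mean_value_bound with (fun t => 2 * F' t / t ^ 2); [lra|intros; apply Hg; lra|].
  intros t Ht; unfold Rdiv.
  rewrite !Rabs_mult, Rabs_inv, (Rabs_pos_eq 2), (Rabs_pos_eq (t ^ 2)) by nra.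
  apply Rle_trans with (2 * (2 * M * t) * / t ^ 2).
  - apply Rmult_le_compat_r; [left; apply Rinv_0_lt_compat; nra|].
    specialize (HF' t ltac:(lra)); lra.
  - replace (2 * (2 * M * t) * / t ^ 2) with (4 * M * / t) by (field; lra).
    apply Rmult_le_compat_l; [lra|]; apply Rinv_le_contravar; lra.
Qed.

(* The derivative of [F - rs/2 g] at [t] is [F' t (t^2 - rs) / t^2]. *)
Lemma spiral_almost_horizontal (s r : R) : 0 < s <= r -> r <= 2 * s -> r < eta ->
  Rabs (F r - F s - / 2 * (r * s) * (g r - g s)) <= 4 * M * (r - s) ^ 2.
Proof.
  intros Hs Hr2 Hr.
  pose proof (mean_value_bound (fun t => F t - / 2 * (r * s) * g t)
    (fun t => F' t - / 2 * (r * s) * (2 * F' t / t ^ 2)) s r (4 * M * (r - s)) (proj2 Hs)) as H.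
  cbv beta in H.
  replace (F r - F s - / 2 * (r * s) * (g r - g s)) with
    (F r - / 2 * (r * s) * g r - (F s - / 2 * (r * s) * g s)) by ring.
  replace (4 * M * (r - s) ^ 2) with (4 * M * (r - s) * (r - s)) by ring.
  apply H; clear H.
  - intros t Ht; apply (is_derive_minus F (fun t => / 2 * (r * s) * g t)); [apply HF; lra|].
    apply is_derive_scal, Hg; lra.
  - intros t Ht.
    replace (F' t - / 2 * (r * s) * (2 * F' t / t ^ 2)) with (F' t * ((t ^ 2 - r * s) / t ^ 2))
      by (field; lra).
    assert (Ht2 : 0 < t ^ 2) by nra.
    unfold Rdiv; rewrite !Rabs_mult, Rabs_inv, (Rabs_pos_eq (t ^ 2)) by lra.
    assert (H1 : Rabs (t ^ 2 - r * s) <= 2 * t * (r - s)) by (apply Rabs_le; split; nra).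
    pose proof (HF' t ltac:(lra)) as H2.
    apply Rle_trans with (2 * M * t * (2 * t * (r - s) * / t ^ 2)).
    + apply Rmult_le_compat; [apply Rabs_pos| |exact H2|].
      * apply Rmult_le_pos; [apply Rabs_pos|left; now apply Rinv_0_lt_compat].
      * apply Rmult_le_compat_r; [left; now apply Rinv_0_lt_compat|exact H1].
    + right; field; lra.
Qed.

(* The square of the Heisenberg distance, up to constants, between the points of [Sigma]
   with polar coordinates [(r, theta)] and [(s, theta - d)]. *)
Definition heis_sq (r s d : R) : R :=
  (r - s) ^ 2 + 2 * (r * s) * (1 - cos d) + Rabs (F r - F s - / 2 * (r * s) * sin d).

Lemma heis_sq_radial (r s d : R) : 0 <= s <= r -> (r - s) ^ 2 <= heis_sq r s d.
Proof.
  intros Hs; unfold heis_sq; pose proof (COS_bound d).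
  pose proof (Rabs_pos (F r - F s - / 2 * (r * s) * sin d)).
  assert (0 <= r * s * (1 - cos d)) by (apply Rmult_le_pos; nra); lra.
Qed.

(** For r >= 2 s both r s and r (r - s) are at most 2 (r - s)^2, so the radial term dominates
    whatever the angle is. *)
Lemma heis_sq_far (r s d : R) : 0 <= s -> 2 * s <= r -> r < eta ->
  heis_sq r s d <= 14 * M * (r - s) ^ 2.
Proof.
  intros Hs Hsr Hr; unfold heis_sq.
  pose proof (COS_bound d); pose proof (SIN_bound d).
  pose proof (profile_increment s r ltac:(lra) Hr) as H1.
  assert (H2 : 0 <= r * s <= 2 * (r - s) ^ 2) by nra.
  assert (H3 : 2 * M * r * (r - s) <= 4 * M * (r - s) ^ 2).
  { replace (2 * M * r * (r - s)) with (2 * M * (r * (r - s))) by ring.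
    replace (4 * M * (r - s) ^ 2) with (2 * M * (2 * (r - s) ^ 2)) by ring.
    apply Rmult_le_compat_l; nra. }
  assert (H4 : Rabs (F r - F s - / 2 * (r * s) * sin d) <= 4 * M * (r - s) ^ 2 + (r - s) ^ 2).
  { apply Rabs_le; apply Rabs_le_between in H1; nra. }
  assert (r * s * (1 - cos d) <= r * s * 2) by (apply Rmult_le_compat_l; lra).
  assert ((r - s) ^ 2 <= M * (r - s) ^ 2) by (pose proof (pow2_ge_0 (r - s)); nra).
  lra.
Qed.

(** With q = g r - g s, the height term and near-horizontality both approximate F r - F s, by r s
    sin d / 2 and by r s q / 2. Subtracting controls r s (sin d - q), and r s (d - sin d) is
    absorbed by the cosine term. *)
Lemma heis_sq_lower (r s d : R) : 0 < s <= r -> r <= 2 * s -> r < eta -> Rabs d <= PI ->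
  s ^ 2 * Rabs (d - (g r - g s)) <= 19 * M * heis_sq r s d.
Proof.
  intros Hs Hr2 Hr Hd; pose proof (heis_sq_radial r s d ltac:(lra)) as H0; unfold heis_sq in *.
  pose proof (spiral_almost_horizontal s r Hs Hr2 Hr) as H1.
  pose proof (sin_diff_bound d) as H2; pose proof (one_minus_cos_lower d Hd) as H3.
  pose proof (pow2_ge_0 (r - s)) as H4.
  assert (Hrs : 0 < s ^ 2 <= r * s) by nra.
  set (p := r * s) in *; set (c := 1 - cos d) in *; set (e := sin d) in *.
  set (h := (r - s) ^ 2) in *; set (q := g r - g s) in *.
  set (b := Rabs (F r - F s - / 2 * p * e)) in *.
  assert (Hc : 0 <= c) by (unfold c; pose proof (COS_bound d); lra).
  assert (Hpc : 0 <= p * c) by (apply Rmult_le_pos; lra).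
  assert (Hb : 0 <= b) by apply Rabs_pos.
  assert (E : p * Rabs (d - q) <= 2 * b + 8 * M * h + p * (18 * c)).
  { replace (p * Rabs (d - q)) with (Rabs (p * (d - q)))
      by (rewrite Rabs_mult, (Rabs_pos_eq p); lra).
    assert (Hpd : Rabs (p * (d - e)) <= p * (18 * c)).
    { rewrite Rabs_mult, (Rabs_pos_eq p) by lra; apply Rmult_le_compat_l; lra. }
    assert (Hbb : - b <= F r - F s - / 2 * p * e <= b) by (apply Rabs_le_between; apply Rle_refl).
    apply Rabs_le_between in Hpd, H1; apply Rabs_le; lra. }
  assert (s ^ 2 * Rabs (d - q) <= p * Rabs (d - q))
    by (apply Rmult_le_compat_r; [apply Rabs_pos|lra]).
  assert (0 <= (M - 1) * h) by (apply Rmult_le_pos; lra).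
  assert (0 <= (M - 1) * b) by (apply Rmult_le_pos; lra).
  assert (0 <= (M - 1) * (p * c)) by (apply Rmult_le_pos; lra).
  nra.
Qed.

(** With a = |d - q| <= pi <= 4, d^2 <= 2 a^2 + 2 q^2 <= 8 a + 2 q^2, and the spiral estimate bounds
    s^2 q^2 by 16 M^2 (r - s)^2. All terms of [heis_sq] then reduce to (r - s)^2 and s^2 a. *)
Lemma heis_sq_upper (r s d : R) : 0 < s <= r -> r <= 2 * s -> r < eta ->
  Rabs (d - (g r - g s)) <= PI ->
  heis_sq r s d <= 101 * M ^ 2 * (r - s) ^ 2 + 25 * (s ^ 2 * Rabs (d - (g r - g s))).
Proof.
  intros Hs Hr2 Hr Hd; unfold heis_sq.
  pose proof (spiral_almost_horizontal s r Hs Hr2 Hr) as H1.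
  pose proof (sin_diff_bound d) as H2; pose proof (one_minus_cos_upper d) as H3.
  pose proof (spiral_increment s r Hs Hr) as H4; pose proof PI_4 as Hpi.
  set (q := g r - g s) in *; set (a := Rabs (d - q)) in *.
  assert (Ha : 0 <= a) by apply Rabs_pos.
  assert (Hrs : 0 < r * s <= 2 * s ^ 2) by nra.
  assert (Hq : s ^ 2 * q ^ 2 <= 16 * M ^ 2 * (r - s) ^ 2).
  { apply (pow_maj_Rabs _ _ 2) in H4.
    replace (16 * M ^ 2 * (r - s) ^ 2) with (s ^ 2 * (4 * M * ((r - s) / s)) ^ 2) by (field; lra).
    apply Rmult_le_compat_l; [apply pow2_ge_0|exact H4]. }
  assert (Hd2 : d ^ 2 <= 8 * a + 2 * q ^ 2).
  { assert (E : (d - q) ^ 2 = a ^ 2) by (unfold a; now rewrite pow2_abs).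
    pose proof (pow2_ge_0 (d - 2 * q)); nra. }
  assert (Hpd : r * s * d ^ 2 <= 16 * (s ^ 2 * a) + 64 * M ^ 2 * (r - s) ^ 2).
  { apply Rle_trans with (2 * s ^ 2 * (8 * a + 2 * q ^ 2)); [|lra].
    apply Rmult_le_compat; [lra|apply pow2_ge_0|lra|lra]. }
  assert (Hcos : 2 * (r * s) * (1 - cos d) <= r * s * d ^ 2).
  { replace (2 * (r * s) * (1 - cos d)) with (r * s * (2 * (1 - cos d))) by ring.
    apply Rmult_le_compat_l; lra. }
  assert (Hpa : r * s * a <= 2 * (s ^ 2 * a)) by nra.
  assert (Hb : Rabs (F r - F s - / 2 * (r * s) * sin d)
    <= 4 * M * (r - s) ^ 2 + / 2 * (r * s * a) + / 2 * (r * s * d ^ 2)).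
  { assert (E1 : Rabs (r * s * (d - q)) <= r * s * a)
      by (rewrite Rabs_mult, (Rabs_pos_eq (r * s)); unfold a; lra).
    assert (E2 : Rabs (r * s * (d - sin d)) <= r * s * d ^ 2)
      by (rewrite Rabs_mult, (Rabs_pos_eq (r * s)) by lra; apply Rmult_le_compat_l; lra).
    apply Rabs_le_between in E1, E2, H1; apply Rabs_le; lra. }
  set (h := (r - s) ^ 2) in *; assert (Hh : 0 <= h) by apply pow2_ge_0.
  assert (HM2 : 1 <= M ^ 2) by nra.
  assert (H5 : h <= M ^ 2 * h) by nra.
  assert (H6 : M * h <= M ^ 2 * h) by (apply Rmult_le_compat_r; nra).
  lra.
Qed.

(** The angle alpha in full turns, the period of [loop]. The value at r = 0 is arbitrary, but
    [cone_map] sends every angle to the apex there. *)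
Definition turns (r theta : R) : R := (theta - g r) / (2 * PI).

(** Both sides are invariant under whole turns, so each inequality may use its own representative.
    If r >= 2 s, both are governed by (r - s)^2. *)
Lemma heis_sq_cone (r s theta phi : R) : 0 <= s <= r -> r < eta ->
  let D := dist4 (cone_map r (turns r theta)) (cone_map s (turns s phi)) ^ 2 in
  D <= 60000 * M * heis_sq r s (theta - phi) /\
  heis_sq r s (theta - phi) <= 3 * 10 ^ 7 * M ^ 2 * D.
Proof.
  intros Hs Hr D; pose proof PI_4 as Hpi4; pose proof PI2_1 as Hpi1.
  pose proof (cone_map_lower_radial r s (turns r theta) (turns s phi)) as Hrad; fold D in Hrad.
  pose proof (heis_sq_radial r s (theta - phi) Hs) as Hrad'.
  pose proof (pow2_ge_0 (r - s)) as Hh.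
  assert (HM2 : M <= M ^ 2) by nra.
  assert (HS : 0 <= heis_sq r s (theta - phi)) by lra.
  assert (HMS : heis_sq r s (theta - phi) <= M * heis_sq r s (theta - phi)) by nra.
  assert (HD : 0 <= D) by lra.
  assert (Shift : forall n : Z, D =
    dist4 (cone_map r (turns r theta + IZR n)) (cone_map s (turns s phi)) ^ 2).
  { intros n; unfold D, cone_map; now rewrite loop_periodic. }
  assert (Hturns : forall n : Z, turns r theta + IZR n - turns s phi =
    ((theta - phi + 2 * PI * IZR n) - (g r - g s)) / (2 * PI)).
  { intros n; unfold turns; field; lra. }
  assert (Hper : forall n : Z, heis_sq r s (theta - phi + 2 * PI * IZR n) =
    heis_sq r s (theta - phi)).
  { intros n; unfold heis_sq; now destruct (sin_cos_periodic (theta - phi) n) as [-> ->]. }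
  destruct (Int_nearest (turns r theta - turns s phi)) as [n Hn].
  replace (turns r theta - turns s phi + IZR n) with
    (turns r theta + IZR n - turns s phi) in Hn by ring.
  destruct (Rle_dec (2 * s) r) as [Hfar|Hnear].
  - split.
    + pose proof (cone_map_upper r s (turns r theta + IZR n) (turns s phi) Hs) as HU.
      rewrite <- Shift in HU.
      assert (s ^ 2 * Rabs (turns r theta + IZR n - turns s phi) <= (r - s) ^ 2 * (1 / 2)).
      { apply Rmult_le_compat; [apply pow2_ge_0|apply Rabs_pos|apply pow_incr; lra|exact Hn]. }
      lra.
    + pose proof (heis_sq_far r s (theta - phi) (proj1 Hs) Hfar Hr).
      assert (M * (r - s) ^ 2 <= M ^ 2 * D) by (apply Rmult_le_compat; lra).
      assert (0 <= M ^ 2 * D) by (apply Rmult_le_pos; nra); lra.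
  - assert (Hs' : 0 < s <= r) by lra; assert (Hr2 : r <= 2 * s) by lra.
    assert (Habs : forall x, Rabs (x / (2 * PI)) = Rabs x / (2 * PI)).
    { intros x; unfold Rdiv; rewrite Rabs_mult, Rabs_inv, (Rabs_pos_eq (2 * PI)); lra. }
    split.
    (* This representative puts theta - phi in [-pi, pi], as [heis_sq_lower] requires; the constant
       is 3072 * 19 plus 25, rounded up. *)
    + destruct (Int_nearest ((theta - phi) / (2 * PI))) as [k Hk].
      replace ((theta - phi) / (2 * PI) + IZR k) with
        ((theta - phi + 2 * PI * IZR k) / (2 * PI)) in Hk by (field; lra).
      rewrite Habs in Hk; apply (Rmult_le_compat_r (2 * PI)) in Hk; [|lra].
      replace (Rabs (theta - phi + 2 * PI * IZR k) / (2 * PI) * (2 * PI)) with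
        (Rabs (theta - phi + 2 * PI * IZR k)) in Hk by (field; lra).
      pose proof (heis_sq_lower r s _ Hs' Hr2 Hr ltac:(apply Rle_trans with (1 := Hk); lra)) as HL.
      rewrite Hper in HL.
      pose proof (cone_map_upper r s (turns r theta + IZR k) (turns s phi) Hs) as HU.
      rewrite <- Shift, Hturns, Habs in HU.
      set (a := Rabs (theta - phi + 2 * PI * IZR k - (g r - g s))) in *.
      assert (a / (2 * PI) <= a).
      { assert (Ha : 0 <= a) by apply Rabs_pos.
        apply (Rmult_le_reg_r (2 * PI)); [lra|].
        replace (a / (2 * PI) * (2 * PI)) with a by (field; lra); nra. }
      assert (s ^ 2 * (a / (2 * PI)) <= s ^ 2 * a)
        by (apply Rmult_le_compat_l; [apply pow2_ge_0|assumption]).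
      lra.
    (* The representative n instead makes alpha - beta at most half a turn; the constant is 25 * 8 *
       9 * 2^14 plus 101, rounded up. *)
    + pose proof (cone_map_lower_angular r s _ _ Hs' Hn) as HL; rewrite <- Shift in HL.
      rewrite Hturns, Habs in Hn, HL.
      set (a := Rabs (theta - phi + 2 * PI * IZR n - (g r - g s))) in *.
      assert (Ha : a = a / (2 * PI) * (2 * PI)) by (field; lra).
      assert (Hq : 0 <= a / (2 * PI)).
      { apply Rmult_le_pos; [apply Rabs_pos|left; apply Rinv_0_lt_compat; lra]. }
      assert (HaPI : a <= PI) by nra.
      pose proof (heis_sq_upper r s _ Hs' Hr2 Hr HaPI) as HU; fold a in HU; rewrite Hper in HU.
      assert (s ^ 2 * a <= 8 * (s ^ 2 * (a / (2 * PI)))).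
      { rewrite Ha at 1; pose proof (pow2_ge_0 s).
        assert (0 <= s ^ 2 * (a / (2 * PI))) by (apply Rmult_le_pos; lra); nra. }
      assert (M ^ 2 * (r - s) ^ 2 <= M ^ 2 * D) by (apply Rmult_le_compat_l; nra).
      assert (1 <= M ^ 2) by nra; assert (D <= M ^ 2 * D) by nra.
      lra.
Qed.

End Profile.

(** * Polar coordinates and the embedding *)

Definition angle (x y : R) : R :=
  let t := acos (x / sqrt (x ^ 2 + y ^ 2)) in if Rle_dec 0 y then t else - t.

Lemma polar (x y : R) : let r := sqrt (x ^ 2 + y ^ 2) in
  x = r * cos (angle x y) /\ y = r * sin (angle x y).
Proof.
  intros r; assert (Hxy : 0 <= x ^ 2 + y ^ 2) by nra.
  assert (Hr : r ^ 2 = x ^ 2 + y ^ 2) by (now apply pow2_sqrt).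
  assert (Hr0 : 0 <= r) by apply sqrt_pos.
  destruct Hr0 as [Hr0|Hr0].
  2:{ rewrite <- Hr0 in *; assert (x = 0 /\ y = 0) as [-> ->] by (split; nra); lra. }
  assert (Hc : -1 <= x / r <= 1).
  { assert (Hx : - r <= x <= r) by (apply abs_le_sq; nra).
    assert (E : x = x / r * r) by (field; lra).
    split; apply (Rmult_le_reg_r r); lra. }
  assert (Hs : r * sqrt (1 - (x / r)²) = Rabs y).
  { rewrite <- (sqrt_Rsqr r) at 1 by lra; rewrite <- sqrt_mult_alt by apply Rle_0_sqr.
    rewrite <- sqrt_Rsqr_abs; f_equal.
    replace (r² * (1 - (x / r)²)) with (r ^ 2 - x ^ 2) by (unfold Rsqr; field; lra).
    rewrite Hr; unfold Rsqr; ring. }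
  unfold angle; fold r; destruct (Rle_dec 0 y) as [Hy|Hy].
  - rewrite cos_acos, sin_acos, Hs, Rabs_pos_eq by lra; split; [field; lra|ring].
  - rewrite cos_neg, sin_neg, cos_acos, sin_acos by lra.
    rewrite Ropp_mult_distr_r_reverse, Hs, Rabs_left by lra; split; [field; lra|ring].
Qed.

Lemma dH_sym (w w' : R * R * R) : dH w w' = dH w' w.
Proof.
  destruct w as [[x y] z], w' as [[x' y'] z']; unfold dH.
  rewrite (Rabs_minus_sym x), (Rabs_minus_sym y), <- (Rabs_Ropp (z - _ + _)).
  do 3 f_equal; ring.
Qed.

Lemma dist4_sym (p q : R * R * R * R) : dist4 p q = dist4 q p.
Proof.
  destruct p as [[[a b] c] d], q as [[[a' b'] c'] d']; unfold dist4; f_equal; ring.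
Qed.

Lemma dH_pos (w w' : R * R * R) : 0 <= dH w w'.
Proof.
  destruct w as [[x y] z], w' as [[x' y'] z']; unfold dH.
  pose proof (Rabs_pos (x - x')); pose proof (Rabs_pos (y - y'));
  pose proof (sqrt_pos (Rabs (z - z' + / 2 * (x * y' - x' * y)))); lra.
Qed.

Lemma dist4_pos (p q : R * R * R * R) : 0 <= dist4 p q.
Proof. destruct p as [[[a b] c] d], q as [[[a' b'] c'] d']; apply sqrt_pos. Qed.

(** The law of cosines identifies the horizontal part, and x y' - x' y = - r s sin(theta - phi) the
    vertical one. The factor 3 compares the square of a sum of three terms with the sum of their
    squares. *)
Lemma dH_heis_sq (F : R -> R) (r s theta phi : R) :
  let D := dH (r * cos theta, r * sin theta, F r) (s * cos phi, s * sin phi, F s) in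
  heis_sq F r s (theta - phi) <= D ^ 2 <= 3 * heis_sq F r s (theta - phi).
Proof.
  intros D.
  set (a := Rabs (r * cos theta - s * cos phi)); set (b := Rabs (r * sin theta - s * sin phi)).
  set (q := Rabs (F r - F s - / 2 * (r * s) * sin (theta - phi))).
  assert (E : heis_sq F r s (theta - phi) = a ^ 2 + b ^ 2 + sqrt q ^ 2).
  { rewrite pow2_sqrt by apply Rabs_pos; unfold a, b; rewrite !pow2_abs.
    unfold heis_sq; fold q; rewrite cos_minus.
    pose proof (sin2_cos2 theta) as H1; pose proof (sin2_cos2 phi) as H2; unfold Rsqr in H1, H2.
    assert (H3 : r ^ 2 * (sin theta * sin theta + cos theta * cos theta) = r ^ 2)
      by (rewrite H1; ring).
    assert (H4 : s ^ 2 * (sin phi * sin phi + cos phi * cos phi) = s ^ 2) by (rewrite H2; ring).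
    lra. }
  assert (ED : D = a + b + sqrt q).
  { unfold D, dH; fold a b; do 2 f_equal; unfold q; f_equal; rewrite sin_minus; ring. }
  assert (Ha : 0 <= a) by apply Rabs_pos; assert (Hb : 0 <= b) by apply Rabs_pos.
  pose proof (sqrt_pos q) as Hq; rewrite E, ED.
  pose proof (Rmult_le_pos _ _ Ha Hb); pose proof (Rmult_le_pos _ _ Ha Hq);
  pose proof (Rmult_le_pos _ _ Hb Hq); pose proof (pow2_ge_0 (a - b));
  pose proof (pow2_ge_0 (a - sqrt q)); pose proof (pow2_ge_0 (b - sqrt q)); split; lra.
Qed.

(** Since L >= 1, A <= L <= L^2, so a constant for squared distances serves for distances without
    taking a root. *)
Lemma biLip_of_squares (L A a b : R) : 1 <= L -> A <= L -> 0 <= a -> 0 <= b ->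
  a ^ 2 <= A * b ^ 2 -> a <= L * b.
Proof.
  intros HL HA Ha Hb H; apply Rnot_lt_le; intros Hlt.
  assert (HLb : 0 <= L * b) by nra.
  assert (H1 : (L * b) ^ 2 < a ^ 2) by nra.
  pose proof (pow2_ge_0 b) as Hb2.
  assert (H2 : A * b ^ 2 <= L * b ^ 2) by nra.
  assert (H3 : L * b ^ 2 <= L * (L * b ^ 2)).
  { rewrite <- (Rmult_1_l (L * b ^ 2)) at 1; apply Rmult_le_compat_r; [nra|lra]. }
  lra.
Qed.

Theorem theorem5p1 :
  exists Lf : R -> R, (forall m, 1 <= m -> 1 < Lf m) /\
  forall F F' : R -> R, C11_halfline F F' -> F' 0 = 0 ->
    exists eps, 0 < eps /\
    exists U : R * R * R -> Prop,
      (forall p, U p -> Sigma F p) /\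
      (forall p, Sigma F p -> dist3 p (0, 0, F 0) < eps -> U p) /\
      biLip_embeds U (Lf (M_of F')).
Proof.
  (* This dominates both 60000 m and 9 * 10^7 m^2, the constants for the squared distances when m >=
     1. *)
  exists (fun m => 10 ^ 9 * m ^ 2); split; [intros m Hm; nra|].
  intros F F' (HF & HF0 & K & HK) HF'0; rewrite HF'0 in HF0.
  destruct (limsup_bound F' K) as (eta & Heta & HF').
  { intros t Ht; specialize (HK t 0 ltac:(lra) ltac:(lra)).
    rewrite HF'0, !Rminus_0_r, (Rabs_pos_eq t) in HK by lra; split.
    - apply Rmult_le_pos; [apply Rabs_pos|left; now apply Rinv_0_lt_compat].
    - apply (Rmult_le_reg_r t); [lra|].
      replace (Rabs (F' t) / t * t) with (Rabs (F' t)) by (field; lra); lra. }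
  destruct (spiral_exists F' K HK) as [g Hg].
  assert (HM : 1 <= M_of F') by apply Rmax_l.
  set (M := M_of F') in *.
  exists eta; split; [exact Heta|].
  (* The Euclidean distance to (0, 0, F 0) is at least the radius, so all radii in this neighborhood
     are below [eta]. *)
  exists (fun p => Sigma F p /\ dist3 p (0, 0, F 0) < eta); split; [tauto|split; [tauto|]].
  set (rad := fun p : R * R * R => let '(x, y, _) := p in sqrt (x ^ 2 + y ^ 2)).
  set (f := fun p : R * R * R => let '(x, y, _) := p in
    cone_map (rad p) (turns g (rad p) (angle x y))).
  assert (Hrad : forall p, dist3 p (0, 0, F 0) < eta -> 0 <= rad p < eta).
  { intros [[x y] z] Hp; split; [apply sqrt_pos|].
    apply Rle_lt_trans with (2 := Hp); unfold rad, dist3; apply sqrt_le_1_alt.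
    pose proof (pow2_ge_0 (z - F 0)); lra. }
  assert (Main : forall p q, Sigma F p -> Sigma F q -> rad q <= rad p ->
    dist3 p (0, 0, F 0) < eta -> dist3 q (0, 0, F 0) < eta ->
    dist4 (f p) (f q) <= 10 ^ 9 * M ^ 2 * dH p q /\
    dH p q <= 10 ^ 9 * M ^ 2 * dist4 (f p) (f q)).
  { intros p q Hp Hq Hqp Bp Bq.
    pose proof (Hrad p Bp) as Rp; pose proof (Hrad q Bq) as Rq.
    pose proof (dH_pos p q) as PH; pose proof (dist4_pos (f p) (f q)) as P4.
    destruct p as [[x y] z], q as [[x' y'] z'].
    unfold f in *; unfold Sigma in Hp, Hq.
    fold (rad (x, y, z)) in Hp; fold (rad (x', y', z')) in Hq.
    destruct (polar x y) as [Ex Ey], (polar x' y') as [Ex' Ey'].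
    fold (rad (x, y, z)) in Ex, Ey; fold (rad (x', y', z')) in Ex', Ey'.
    set (theta := angle x y) in *; set (phi := angle x' y') in *.
    pose proof (heis_sq_cone F F' g M eta HM HF HF0 HF' Hg (rad (x, y, z)) (rad (x', y', z'))
      theta phi ltac:(lra) ltac:(lra)) as [C1 C2].
    pose proof (dH_heis_sq F (rad (x, y, z)) (rad (x', y', z')) theta phi) as [C3 C4].
    cbv zeta in *; rewrite <- Ex, <- Ey, <- Ex', <- Ey', <- Hp, <- Hq in C3, C4.
    assert (HM2 : M <= M ^ 2) by nra.
    split.
    - apply biLip_of_squares with (60000 * M); try assumption; try lra.
      apply Rle_trans with (1 := C1); apply Rmult_le_compat_l; lra.
    - apply biLip_of_squares with (9 * 10 ^ 7 * M ^ 2); try assumption; lra. }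
  exists f; intros p q [Hp Bp] [Hq Bq].
  assert (Both : dist4 (f p) (f q) <= 10 ^ 9 * M ^ 2 * dH p q /\
    dH p q <= 10 ^ 9 * M ^ 2 * dist4 (f p) (f q)).
  (* The cone estimates assume the first radius to be the larger one; symmetry of both distances
     covers the other order. *)
  { destruct (Rle_dec (rad q) (rad p)); [now apply Main|].
    rewrite dist4_sym, dH_sym; apply Main; auto; lra. }
  destruct Both as [B1 B2]; split; [|exact B1].
  assert (HL : 0 < 10 ^ 9 * M ^ 2) by nra.
  apply (Rmult_le_reg_l (10 ^ 9 * M ^ 2)); [exact HL|].
  rewrite <- Rmult_assoc, Rinv_r, Rmult_1_l by lra; exact B2.
Qed.
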